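(* Let $2<p<\infty$ and let $\mathbf m=(m_k)_{k\ge0}$ be any sequence of integers with $m_k\ge2$. Set $\mathcal N_{\mathbf m}=L^\infty(G_{\mathbf m})\,\overline\otimes\,B(\ell^2)$, endowed with the tensor-product trace. Then neither of the following two estimates holds with a finite constant $C$ uniformly for all $f\in L^p(\mathcal N_{\mathbf m})$ and all finite families $(I_s)_s$ of pairwise disjoint intervals of equal length (cardinality) in $\mathbb N$: $$\Bigl\|\Bigl(\sum_s|P_{I_s}f|^2\Bigr)^{1/2}\Bigr\|_{L^p(\mathcal N_{\mathbf m})}\le C\|f\|_{L^p(\mathcal N_{\mathbf m})},$$ $$\Bigl\|\Bigl(\sum_s|(P_{I_s}f)^*|^2\Bigr)^{1/2}\Bigr\|_{L^p(\mathcal N_{\mathbf m})}\le C\|f\|_{L^p(\mathcal N_{\mathbf m})}.$$ Consequently, for every $2<p<\infty$, the Schatten class $S^p=S^p(B(\ell^2))$ does not satisfy the $\mathrm{LPR}_{p,=}$ property (with respect to $\mathbf m$).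
   Context: $\mathbb N=\{0,1,2,\dots\}$; for integers $a<b$, $[a,b)$ is the set of integers $n$ with $a\le n<b$; an interval in $\mathbb N$ is such a set. $G_{\mathbf m}=\prod_{k\ge0}\mathbb Z_{m_k}$ with normalized Haar measure $\mu$. Put $M_0=1$, $M_{k+1}=m_kM_k$. Each $n\in\mathbb N$ has a unique expansion $n=\sum_{k\ge0}n_kM_k$ with $0\le n_k<m_k$ (finitely many nonzero digits). For $x=(x_k)_k\in G_{\mathbf m}$ let $\psi_n(x)=\prod_{k\ge0}e^{2\pi i n_kx_k/m_k}$. The trace on $\mathcal N_{\mathbf m}$ is the tensor product of integration against $\mu$ with the standard trace $\mathrm{Tr}$ on $B(\ell^2)$, $L^p(\mathcal N_{\mathbf m})$ is the associated noncommutative $L^p$-space, which is identified with the Bochner space $L^p(G_{\mathbf m};S^p)$, where $S^p$ is the Schatten class with norm $\|A\|_{S^p}=(\mathrm{Tr}|A|^p)^{1/p}$. For $A$ an operator, $|A|^2=A^*A$ (so $|A^*|^2=AA^*$). For $f$ in this space (more generally $f\in L^p(G_{\mathbf m};X)$, $X$ a Banach space), $\widehat f(n)=\int_{G_{\mathbf m}}f\,\overline{\psi_n}\,d\mu$, and for finite $I\subset\mathbb N$, $P_If=\sum_{n\in I}\widehat f(n)\psi_n$. A Banach space $X$ has the $\mathrm{LPR}_{p,=}$ property if there is a finite constant $C=C_{p,X,\mathbf m}$ such that $$\Bigl(\mathbb E_\varepsilon\Bigl\|\sum_s\varepsilon_sP_{I_s}f\Bigr\|_{L^p(G_{\mathbf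 m};X)}^p\Bigr)^{1/p}\le C\,\|f\|_{L^p(G_{\mathbf m};X)}$$ for every finite family $(I_s)_s$ of pairwise disjoint intervals in $\mathbb N$ of equal cardinality and every $f\in L^p(G_{\mathbf m};X)$, where $(\varepsilon_s)_s$ is an i.i.d. Rademacher ($\pm1$) sequence on an auxiliary probability space. *)

(* Defs.v *)
From HB Require Import structures.
From mathcomp Require Import all_boot all_order all_algebra complex.
From mathcomp Require Import all_classical all_reals all_analysis ring.

Set Implicit Arguments.
Unset Strict Implicit.
Unset Printing Implicit Defensive.
Import Order.TTheory GRing.Theory Num.Theory.
Import numFieldNormedType.Exports.
Local Open Scope classical_set_scope.
Local Open Scope ring_scope.

(** * The Hilbert space l^2 over R[i] *)

Section Ell2.
Context {R : realType}.
Implicit Types u v : nat -> R[i].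

Definition sqsum u : \bar R := (\sum_(i <oo) (Normc.normc (u i) ^+ 2)%:E)%E.

Definition sqsummable : {pred (nat -> R[i])} :=
  fun u => `[< (sqsum u < +oo)%E >].

Lemma sqsummable_lin (c : R[i]) u v :
  u \in sqsummable -> v \in sqsummable -> c *: u + v \in sqsummable.
Proof.
rewrite !unfold_in => /asboolP hu /asboolP hv; apply/asboolP.
pose k := 2 * Normc.normc c ^+ 2.
have k0 : 0 <= k by rewrite mulr_ge0 ?sqr_ge0.
have le1 : (sqsum (c *: u + v)%R <= k%:E * sqsum u + 2%:E * sqsum v)%E.
  rewrite /sqsum -!nneseriesZl; try by move=> i _; rewrite lee_fin sqr_ge0.
  rewrite -nneseriesD; last 2 first.
  - by move=> i _ _; rewrite mule_ge0 ?lee_fin ?sqr_ge0.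
  - by move=> i _ _; rewrite mule_ge0 ?lee_fin ?sqr_ge0.
  apply: lee_nneseries => i _; first by rewrite lee_fin sqr_ge0.
  rewrite -!EFinM -EFinD lee_fin /k.
  have : 0 <= Normc.normc (c * u i + v i) by case: (_ + _) => ? ?; rewrite sqrtr_ge0.
  have := @le_normcD R (c * u i) (v i); rewrite Normc.normcM => h1 h0.
  apply: (le_trans (y := (Normc.normc c * Normc.normc (u i) + Normc.normc (v i)) ^+ 2)).
    by rewrite lerXn2r // nnegrE (le_trans h0 h1).
  rewrite -subr_ge0 [X in 0 <= X](_ : _ =
    (Normc.normc c * Normc.normc (u i) - Normc.normc (v i)) ^+ 2) ?sqr_ge0 //.
  by rewrite !expr2; ring.
apply: le_lt_trans le1 _.
have fin w : (sqsum w < +oo)%E -> sqsum w \is a fin_num.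
  move=> h; rewrite ge0_fin_numE //.
  by apply: nneseries_ge0 => i _ _; rewrite lee_fin sqr_ge0.
by rewrite -(fineK (fin _ hu)) -(fineK (fin _ hv)) -!EFinM -EFinD ltry.
Qed.

Lemma sqsummable_submod : submod_closed sqsummable.
Proof.
split; last exact: sqsummable_lin.
rewrite unfold_in; apply/asboolP; rewrite /sqsum eseries0 // => i _ _.
by rewrite Normc.normc0 expr0n.
Qed.

HB.instance Definition _ :=
  GRing.isSubmodClosed.Build R[i] (nat -> R[i]) sqsummable sqsummable_submod.

Lemma sqsummable_delta (n : nat) :
  (fun i : nat => ((i == n)%:R : R[i])) \in sqsummable.
Proof.
rewrite unfold_in; apply/asboolP; rewrite /sqsum (nneseries_split _ n.+1); last first.
  by move=> i _; rewrite lee_fin sqr_ge0.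
rewrite eseries0 ?adde0.
  by rewrite sumEFin ltry.
move=> i hi _; rewrite add0n in hi.
by rewrite (gtn_eqF hi) Normc.normc0 expr0n.
Qed.

End Ell2.

Record ell2 (R : realType) := Ell2 {
  ell2_val :> nat -> R[i] ;
  ell2P : ell2_val \in sqsummable }.

HB.instance Definition _ (R : realType) := [isSub for @ell2_val R].
HB.instance Definition _ (R : realType) := [Choice of ell2 R by <:].
HB.instance Definition _ (R : realType) :=
  [SubChoice_isSubLmodule of ell2 R by <:].

Section Operators.
Context {R : realType}.
Implicit Types (u v : ell2 R) (A B S T : ell2 R -> ell2 R) (a p : R).

Definition dot u v : R[i] :=
  let z i := u i * conjc (v i) in
  Complex (limn (series (fun i => complex.Re (z i))))
          (limn (series (fun i => complex.Im (z i)))).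

Definition l2norm u : R := Num.sqrt (fine (sqsum u)).

Definition unit_vec (n : nat) : ell2 R := Ell2 (sqsummable_delta n).

(* membership in B(l^2) *)
Definition bounded_op A : Prop :=
  linear A /\ exists c : R, forall u, l2norm (A u) <= c * l2norm u.

Definition adjop A : ell2 R -> ell2 R :=
  xget 0 [set B | forall u v, dot (A u) v = dot u (B v)].

Definition orthonormal_basis (e : nat -> ell2 R) : Prop :=
  (forall i j, dot (e i) (e j) = (i == j)%:R) /\
  (forall u, (forall i, dot u (e i) = 0) -> u = 0).

(* [S] is the power [T ^ a] of the positive operator [T], by functional
   calculus on the spectral decomposition of [T]. Every positive compact
   operator on l^2 has an orthonormal basis of eigenvectors. *)
Definition is_opow T a S : Prop :=
  [/\ bounded_op T, bounded_op S &
  exists (e : nat -> ell2 R) (lam : nat -> R),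
    orthonormal_basis e /\
    forall n, [/\ 0 <= lam n, T (e n) = (lam n)%:C%C *: e n &
                  S (e n) = (lam n `^ a)%:C%C *: e n]].

Definition opow T a : ell2 R -> ell2 R := xget 0 [set S | is_opow T a S].

Definition sqrtop T := opow T 2^-1.

(* |A|^2 *)
Definition sqabs A := adjop A \o A.

(* |A| *)
Definition absop A := sqrtop (sqabs A).

(* the trace of a positive operator *)
Definition trace T : \bar R :=
  (\sum_(i <oo) (complex.Re (dot (T (unit_vec i)) (unit_vec i)))%:E)%E.

(* The norm of the Schatten class S^p = {A | schatten p A < +oo}. A bounded
   [A] for which [sqabs A] has no orthonormal eigenbasis is not compact, hence
   Tr |A|^p = +oo. *)
Definition schatten p A : \bar R :=
  if `[< bounded_op A /\ exists S, is_opow (sqabs A) 2^-1 S >]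
  then (trace (opow (absop A) p) `^ p^-1)%E
  else +oo%E.

End Operators.

(** * Bochner integration *)

(* A Banach space X is presented by a complex vector space [V] and an extended
   norm [nrm]: X is the subspace where [nrm] is finite. *)

Section Bochner.
Context {R : realType} {d : measure_display} {T : measurableType d}.
Context (mu : {measure set T -> \bar R}) {V : lmodType R[i]}.
Context (nrm : V -> \bar R).
Implicit Types (f s : T -> V) (v : V).

Definition simple s : Prop :=
  [/\ forall x, (nrm (s x) < +oo)%E, finite_set (range s) &
      forall v, measurable (s @^-1` [set v])].

Definition simple_integral s : V :=
  \sum_(v \in range s) (fine (mu (s @^-1` [set v])))%:C%C *: v.

Definition strongly_measurable f : Prop :=
  exists s : nat -> T -> V, (forall k, simple (s k)) /\
    {ae mu, forall x, nrm (f x - s k x) @[k --> \oo] --> 0%E}.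

Definition is_bochner f v : Prop :=
  (nrm v < +oo)%E /\
  exists s : nat -> T -> V,
  [/\ forall k, simple (s k),
      {ae mu, forall x, nrm (f x - s k x) @[k --> \oo] --> 0%E},
      (\int[mu]_x nrm (f x - s k x))%E @[k --> \oo] --> 0%E &
      nrm (simple_integral (s k) - v) @[k --> \oo] --> 0%E].

Definition bochner f : V := xget 0 [set v | is_bochner f v].

Definition Lp_norm (p : R) f : \bar R := Lnorm mu p%:E (nrm \o f).

(* f belongs to L^p(T; X) *)
Definition in_Lp (p : R) f : Prop :=
  [/\ forall x, (nrm (f x) < +oo)%E, strongly_measurable f &
      (Lp_norm p f < +oo)%E].

End Bochner.

(** * The group G_m and its characters *)

(* Meaningful when every [m k >= 2]. *)
Definition Gpt (m : nat -> nat) := forall k, 'Z_(m k).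
HB.instance Definition _ m := gen_eqMixin (Gpt m).
HB.instance Definition _ m := gen_choiceMixin (Gpt m).
HB.instance Definition _ m := isPointed.Build (Gpt m) (fun k => 0).

(* The Borel sigma-algebra of the product topology is generated by the
   one-coordinate cylinders. *)
Definition cylinders (m : nat -> nat) : set (set (Gpt m)) :=
  [set A | exists (k : nat) (j : 'Z_(m k)), A = [set x : Gpt m | x k = j]].

Notation G m := (g_sigma_algebraType (@cylinders m)).

Section Vilenkin.
Context {R : realType} (m : nat -> nat).

(* Translation-invariant probability measures: there is exactly one. *)
Definition is_haar (mu : probability (G m) R) : Prop :=
  forall (g : Gpt m) (A : set (G m)), measurable A ->
    mu [set x | A (fun k => (x k + g k)%R)] = mu A.

Definition M (k : nat) : nat := (\prod_(j < k) m j)%N.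

Definition digit (n k : nat) : nat := ((n %/ M k) %% m k)%N.

(* As n < M n, the digits of index k >= n vanish. *)
Definition psi (n : nat) (x : G m) : R[i] :=
  \prod_(k < n)
    let t : R := 2 * pi * (digit n k)%:R * (nat_of_ord (x k))%:R / (m k)%:R in
    Complex (cos t) (sin t).

Context (mu : probability (G m) R).

Section Multiplier.
Context {V : lmodType R[i]} (nrm : V -> \bar R).

Definition fourier (f : G m -> V) (n : nat) : V :=
  bochner mu nrm (fun x => conjc (psi n x) *: f x).

(* P_I f for I = [a, b) *)
Definition P_I (a b : nat) (f : G m -> V) (x : G m) : V :=
  \sum_(a <= n < b) psi n x *: fourier f n.

End Multiplier.

(* The intervals I_s = [a s, b s), s < N, are pairwise disjoint and of equal
   cardinality. *)
Definition equal_disjoint (N : nat) (a b : 'I_N -> nat) : Prop :=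
  [/\ forall s, (a s < b s)%N,
      forall s t, (b s - a s = b t - a t)%N &
      forall s t, s != t -> forall n : nat,
        ~ ((a s <= n < b s)%N /\ (a t <= n < b t)%N)].

(* The expectation over N independent Rademacher variables is the average over
   all choices of N signs. *)
Definition LPR_eq (p : R) (V : lmodType R[i]) (nrm : V -> \bar R) : Prop :=
  exists C : R, forall (N : nat) (a b : 'I_N -> nat), equal_disjoint a b ->
    forall f : G m -> V, in_Lp mu nrm p f ->
    (((2 ^+ N)^-1%:E *
      \sum_(eps : {ffun 'I_N -> bool})
        Lp_norm mu nrm p
          (fun x => (\sum_(s < N) (-1) ^+ eps s *: P_I nrm (a s) (b s) f x)%R) `^ p)
       `^ p^-1
     <= C%:E * Lp_norm mu nrm p f)%E.

Definition column_estimate (p : R) : Prop :=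
  exists C : R, forall (N : nat) (a b : 'I_N -> nat), equal_disjoint a b ->
    forall f : G m -> (ell2 R -> ell2 R), in_Lp mu (schatten p) p f ->
    (Lp_norm mu (schatten p) p
       (fun x => sqrtop (\sum_(s < N) sqabs (P_I (schatten p) (a s) (b s) f x))%R)
     <= C%:E * Lp_norm mu (schatten p) p f)%E.

Definition row_estimate (p : R) : Prop :=
  exists C : R, forall (N : nat) (a b : 'I_N -> nat), equal_disjoint a b ->
    forall f : G m -> (ell2 R -> ell2 R), in_Lp mu (schatten p) p f ->
    (Lp_norm mu (schatten p) p
       (fun x => sqrtop
          (\sum_(s < N) sqabs (adjop (P_I (schatten p) (a s) (b s) f x)))%R)
     <= C%:E * Lp_norm mu (schatten p) p f)%E.

End Vilenkin.

(* Main.v *)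
(** Index the rows of an [N x n] sign matrix by all [N = 2^n] sign patterns [s],
    and put [c_s = 2 s M_n + r_s], where the digit [k] of [r_s < M_n] is [0] when
    [s_k = 1] and [m_k - 1] when [s_k = -1]. Adding [1] modulo [m_k] to the digit
    [k] of [c_s] gives a frequency [n(s, k)] with
    [psi_(n(s, k)) = psi_(c_s) psi_(M_k)], which lies in [I_s = [c_s, c_s + M_n)]
    exactly when [s_k = 1]: in the other case the carry is lost and the frequency
    decreases. Let [f = \sum_(s, k) s_k psi_(n(s, k)) e_(s k)]. Pointwise, [f] is
    the sign matrix multiplied on both sides by diagonal unitaries. The columns of
    the sign matrix are orthogonal, so [|f|^2 = N] and
    [||f||_p = N^(1/2) n^(1/p)]. The projections [P_(I_s)] replace the entries
    [-1] of the row [s] by [0], and the square function becomes the modulus of a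
    matrix [W] such that [W^* W = (N / 4) (J + 1)] up to a diagonal unitary, [J]
    being the matrix with all entries [1]. Its largest eigenvalue is
    [N (n + 1) / 4], so that the ratio of the norms is at least
    [n^(1/2 - 1/p) / 2], which is unbounded for [p > 2]. Random signs only multiply
    the rows of [W] and do not change [W^* W], and transposing [f] exchanges the
    column and the row square functions. *)

(* Characters multiply by adding digits modulo m_k without carry, whereas an interval is cut out by
   the order of the integers. A digit that wraps around lowers the integer, and this mismatch lets
   intervals of one common length select entries by their sign. The factor 2 in 2 s M_n leaves room:
   I_s starts in the first half of the block [2 s M_n, 2 (s + 1) M_n) and ends inside that block, so
   distinct rows do not interact.

   The sign matrix has n equal singular values N^(1/2). Its 0-1 version is half of its sum with the
   all-ones matrix, a rank-one summand whose norm (N n)^(1/2) sits in a single direction. The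
   exponent p > 2 enters when n^(1/p) is compared with n^(1/2).

   [schatten] is defined for all operators through a chosen functional calculus, and Bochner
   integrals through arbitrary approximating simple functions. Norms are therefore computed from
   Gram matrices and integrals are identified by their matrix entries, so that the triangle
   inequality of S^p is never proved. *)
Require Import Defs.
From mathcomp Require Import all_boot all_order all_algebra complex.
From mathcomp Require Import all_classical all_reals all_analysis.
From mathcomp Require Import finmap measurable_realfun spectral ring lra zify.

Set Implicit Arguments.
Unset Strict Implicit.
Unset Printing Implicit Defensive.
Import Order.TTheory GRing.Theory Num.Theory.
Import numFieldNormedType.Exports.
Local Open Scope classical_set_scope.
Local Open Scope ring_scope.

(** * Complex numbers and complex series *)

Section ComplexModulus.
Context {R : rcfType}.
Implicit Types z w : R[i].
Local Notation nc := (@Normc.normc R).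

Lemma normc_ge0 z : 0 <= nc z.
Proof. by case: z => a b; rewrite sqrtr_ge0. Qed.

Lemma normc_sqr z : nc z ^+ 2 = complex.Re z ^+ 2 + complex.Im z ^+ 2.
Proof. by case: z => a b; rewrite /= sqr_sqrtr // addr_ge0 // sqr_ge0. Qed.

Lemma mul_conjc z : z * conjc z = (nc z ^+ 2)%:C%C.
Proof.
rewrite normc_sqr; case: z => a b; apply/eqP; rewrite eq_complex /=.
by apply/andP; split; apply/eqP; ring.
Qed.

Lemma normc_conjc z : nc (conjc z) = nc z.
Proof. by case: z => a b; rewrite /= sqrrN. Qed.

Lemma normc_real (r : R) : nc r%:C%C = `|r|.
Proof. by rewrite /= expr0n addr0 sqrtr_sqr. Qed.

Lemma normc_triangle z w : nc (z + w) <= nc z + nc w.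
Proof. exact: le_normcD. Qed.

Lemma normc_opp z : nc (- z) = nc z.
Proof. exact: normcN. Qed.

Lemma normc_Re z : `|complex.Re z| <= nc z.
Proof.
rewrite -(@ler_pXn2r _ 2) ?nnegrE ?normc_ge0 // real_normK ?num_real // normc_sqr.
by rewrite lerDl sqr_ge0.
Qed.

Lemma normc_Im z : `|complex.Im z| <= nc z.
Proof.
rewrite -(@ler_pXn2r _ 2) ?nnegrE ?normc_ge0 // real_normK ?num_real // normc_sqr.
by rewrite lerDr sqr_ge0.
Qed.

Lemma Re_rscale (r : R) z : complex.Re (r%:C%C * z) = r * complex.Re z.
Proof. by case: z => a b /=; rewrite mul0r subr0. Qed.

Lemma normc_sum (I : Type) (r : seq I) (P : pred I) (F : I -> R[i]) :
  nc (\sum_(i <- r | P i) F i) <= \sum_(i <- r | P i) nc (F i).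
Proof.
elim/big_rec2: _ => [|i y x _ h]; first by rewrite Normc.normc0.
by apply: le_trans (normc_triangle _ _) _; rewrite lerD2l.
Qed.

Lemma ReD z w : complex.Re (z + w) = complex.Re z + complex.Re w.
Proof. by case: z w => a b [c d]. Qed.

Lemma ReB z w : complex.Re (z - w) = complex.Re z - complex.Re w.
Proof. by case: z w => a b [c d]. Qed.

Lemma ImB z w : complex.Im (z - w) = complex.Im z - complex.Im w.
Proof. by case: z w => a b [c d]. Qed.

Lemma conjcD z w : conjc (z + w) = conjc z + conjc w.
Proof. exact: (rmorphD (@conjc R)). Qed.

Lemma conjcB z w : conjc (z - w) = conjc z - conjc w.
Proof. exact: (rmorphB (@conjc R)). Qed.

Lemma conjcM z w : conjc (z * w) = conjc z * conjc w.
Proof. exact: (rmorphM (@conjc R)). Qed.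

Lemma conjc_sum (I : Type) (r : seq I) (P : pred I) (F : I -> R[i]) :
  conjc (\sum_(i <- r | P i) F i) = \sum_(i <- r | P i) conjc (F i).
Proof. exact: (rmorph_sum (@conjc R)). Qed.

(** The spectral theorem is stated with [Num.conj], the inner product with [conjc]. Either conjugate
    times z gives |z|^2, and z cancels. *)
Lemma conjC_conjc z : Num.conj z = conjc z.
Proof.
have [->|z0] := eqVneq z 0; first by rewrite !rmorph0.
have h : z * Num.conj z = z * conjc z by rewrite -normCK sqr_normc.
exact: mulfI z0 _ _ h.
Qed.

End ComplexModulus.

Section ComplexSeries.
Context {R : realType}.
Implicit Types z w : nat -> R[i].
Local Notation nc := (@Normc.normc R).
Local Notation CRe := complex.Re.
Local Notation CIm := complex.Im.

(** The form that [dot] unfolds to. [limn] is meaningful only for convergent series, so the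
    algebraic rules below assume [abs_summable]. *)
Definition csum z : R[i] :=
  Complex (limn (series (fun i => CRe (z i)))) (limn (series (fun i => CIm (z i)))).

Definition abs_summable z : Prop :=
  exists r : R, forall n, \sum_(0 <= i < n) nc (z i) <= r.

Lemma bounded_nnseries_cvg (u : nat -> R) (r : R) : (forall i, 0 <= u i) ->
  (forall n, \sum_(0 <= i < n) u i <= r) -> cvgn (series u).
Proof.
move=> u0 ur; apply: nondecreasing_is_cvgn; first exact: nondecreasing_series.
by exists r => _ [n _ <-]; apply: ur.
Qed.

Lemma dominated_series_cvg (u : nat -> R) z : abs_summable z ->
  (forall i, `|u i| <= nc (z i)) -> cvgn (series u).
Proof.
move=> [r zr] uz; apply: normed_cvg.
apply: (@bounded_nnseries_cvg _ r) => [i|n]; first exact: normr_ge0.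
by apply: le_trans (zr n); apply: ler_sum => i _; exact: uz.
Qed.

Lemma abs_summable_Re z : abs_summable z -> cvgn (series (fun i => CRe (z i))).
Proof. by move/dominated_series_cvg; apply => i; exact: normc_Re. Qed.

Lemma abs_summable_Im z : abs_summable z -> cvgn (series (fun i => CIm (z i))).
Proof. by move/dominated_series_cvg; apply => i; exact: normc_Im. Qed.

Lemma csumD z w : abs_summable z -> abs_summable w ->
  csum (fun i => z i + w i) = csum z + csum w.
Proof.
move=> sz sw; rewrite /csum.
have -> : (fun i => CRe (z i + w i)) = (fun i => CRe (z i)) + (fun i => CRe (w i)).
  by apply/funext => i; rewrite raddfD.
have -> : (fun i => CIm (z i + w i)) = (fun i => CIm (z i)) + (fun i => CIm (w i)).
  by apply/funext => i; rewrite raddfD.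
by rewrite (lim_seriesD (abs_summable_Re sz) (abs_summable_Re sw))
  (lim_seriesD (abs_summable_Im sz) (abs_summable_Im sw)).
Qed.

Lemma csumZ (c : R[i]) z : abs_summable z -> csum (fun i => c * z i) = c * csum z.
Proof.
move=> sz; rewrite /csum; have zr := abs_summable_Re sz; have zi := abs_summable_Im sz.
case: c => a b.
have -> : (fun i => CRe (Complex a b * z i)) =
    a *: (fun i => CRe (z i)) - b *: (fun i => CIm (z i)).
  by apply/funext => i; rewrite !fctE; case: (z i).
have -> : (fun i => CIm (Complex a b * z i)) =
    a *: (fun i => CIm (z i)) + b *: (fun i => CRe (z i)).
  by apply/funext => i; rewrite !fctE; case: (z i).
rewrite (lim_seriesB (is_cvg_seriesZ (k := a) zr) (is_cvg_seriesZ (k := b) zi)).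
rewrite (lim_seriesD (is_cvg_seriesZ (k := a) zi) (is_cvg_seriesZ (k := b) zr)).
by rewrite !(lim_seriesZ _ zr) !(lim_seriesZ _ zi).
Qed.

Lemma csum_conj z : abs_summable z -> csum (fun i => conjc (z i)) = conjc (csum z).
Proof.
move=> sz; rewrite /csum /=.
have -> : (fun i => CRe (conjc (z i))) = (fun i => CRe (z i)).
  by apply/funext => i; case: (z i).
have -> : (fun i => CIm (conjc (z i))) = - (fun i => CIm (z i)).
  by apply/funext => i; rewrite !fctE; case: (z i).
by rewrite lim_seriesN //; exact: abs_summable_Im.
Qed.

Lemma limn_series_finite (u : nat -> R) n : (forall i, (n <= i)%N -> u i = 0) ->
  limn (series u) = \sum_(0 <= i < n) u i.
Proof.
move=> h; apply: (@lim_near_cst R) => //; exists n => // k /= nk.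
rewrite seriesEnat /= (@big_cat_nat _ _ _ n) //= [X in _ + X]big_nat_cond.
rewrite [X in _ + X]big1 ?addr0 //.
by move=> i /andP[/andP[ni _] _]; exact: h.
Qed.

Lemma csum_finite z n : (forall i, (n <= i)%N -> z i = 0) ->
  csum z = \sum_(0 <= i < n) z i.
Proof.
move=> h; rewrite /csum (@limn_series_finite _ n) ?(@limn_series_finite _ n).
- by apply/eqP; rewrite eq_complex !raddf_sum /= !eqxx.
- by move=> i /h ->.
- by move=> i /h ->.
Qed.

End ComplexSeries.

(** * The Hilbert space l^2 *)

Arguments dot : simpl never.

Section Ell2Space.
Context {R : realType}.
Local Notation H := (ell2 R).
Implicit Types (u v w : H) (c : R[i]).
Local Notation nc := (@Normc.normc R).
Local Notation CRe := complex.Re.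

Lemma ell2_ext u v : (forall i, u i = v i) -> u = v.
Proof. by move=> h; apply: val_inj; apply/funext. Qed.

Lemma ell2D u v i : (u + v) i = u i + v i. Proof. by []. Qed.
Lemma ell2Z c u i : (c *: u) i = c * u i. Proof. by []. Qed.
Lemma ell2B u v i : (u - v) i = u i - v i. Proof. by []. Qed.

Lemma ell2_sum (I : Type) (r : seq I) (P : pred I) (F : I -> H) i :
  (\sum_(j <- r | P j) F j) i = \sum_(j <- r | P j) F j i.
Proof. by elim/big_rec2: _ => // j x y _ <-. Qed.

Lemma sqsum_ge (u : nat -> R[i]) n :
  ((\sum_(0 <= i < n) nc (u i) ^+ 2)%:E <= sqsum u)%E.
Proof.
rewrite -sumEFin; apply: nneseries_lim_ge => i _ _.
by rewrite lee_fin sqr_ge0.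
Qed.

Lemma sqsum_le (u : nat -> R[i]) (r : R) :
  (forall n, \sum_(0 <= i < n) nc (u i) ^+ 2 <= r) -> (sqsum u <= r%:E)%E.
Proof.
move=> h; apply: lime_le.
  by apply: is_cvg_nneseries => i _ _; rewrite lee_fin sqr_ge0.
by apply: nearW => n; rewrite sumEFin lee_fin.
Qed.

Lemma sqsum_fin u : sqsum u \is a fin_num.
Proof.
rewrite ge0_fin_numE; last by apply: nneseries_ge0 => i _ _; rewrite lee_fin sqr_ge0.
by have /asboolP := ell2P u.
Qed.

Lemma sqsummable_le (u : nat -> R[i]) (r : R) :
  (forall n, \sum_(0 <= i < n) nc (u i) ^+ 2 <= r) -> u \in sqsummable.
Proof.
by move=> h; apply/asboolP; apply: le_lt_trans (sqsum_le h) _; rewrite ltry.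
Qed.

Lemma l2norm_sqr u : (l2norm u ^+ 2)%:E = sqsum u.
Proof.
rewrite /l2norm sqr_sqrtr ?fineK ?sqsum_fin //.
by apply: fine_ge0; apply: nneseries_ge0 => i _ _; rewrite lee_fin sqr_ge0.
Qed.

Lemma l2norm_ge0 u : 0 <= l2norm u. Proof. exact: sqrtr_ge0. Qed.
#[local] Hint Resolve l2norm_ge0 : core.

Lemma partial_le_l2norm u n : \sum_(0 <= i < n) nc (u i) ^+ 2 <= l2norm u ^+ 2.
Proof. by rewrite -lee_fin l2norm_sqr sqsum_ge. Qed.

Lemma l2norm_sqr_le u (r : R) :
  (forall n, \sum_(0 <= i < n) nc (u i) ^+ 2 <= r) -> l2norm u ^+ 2 <= r.
Proof. by move=> h; rewrite -lee_fin l2norm_sqr sqsum_le. Qed.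

Lemma ler_sqr_pos (x y : R) : 0 <= y -> x ^+ 2 <= y ^+ 2 -> x <= y.
Proof.
move=> y0; have [x0|/ltW x0] := leP 0 x; last by move=> _; apply: le_trans y0.
by rewrite ler_pXn2r.
Qed.

Lemma coord_le_l2norm u i : nc (u i) <= l2norm u.
Proof.
apply: ler_sqr_pos => //; apply: le_trans (partial_le_l2norm u i.+1).
by rewrite big_nat_recr //= lerDr; apply: sumr_ge0 => j _; apply: sqr_ge0.
Qed.

(** Termwise 2 x y <= x^2 + y^2. The sesquilinearity of [dot] rests on this. *)
Lemma dot_summable u v : abs_summable (fun i => u i * conjc (v i)).
Proof.
exists ((l2norm u ^+ 2 + l2norm v ^+ 2) / 2) => n.
apply: (@le_trans _ _ (\sum_(0 <= i < n) (nc (u i) ^+ 2 + nc (v i) ^+ 2) / 2)).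
  apply: ler_sum => i _; rewrite Normc.normcM normc_conjc.
  have := sqr_ge0 (nc (u i) - nc (v i)); nra.
by rewrite -mulr_suml ler_wpM2r ?invr_ge0 ?ler0n // big_split lerD ?partial_le_l2norm.
Qed.

Lemma dotE u v : dot u v = csum (fun i => u i * conjc (v i)).
Proof. by []. Qed.

Lemma dotDl u v w : dot (u + v) w = dot u w + dot v w.
Proof.
rewrite !dotE -csumD; do ?exact: dot_summable.
by congr csum; apply/funext => i; rewrite ell2D mulrDl.
Qed.

Lemma dotZl c u v : dot (c *: u) v = c * dot u v.
Proof.
rewrite !dotE -csumZ; last exact: dot_summable.
by congr csum; apply/funext => i; rewrite ell2Z mulrA.
Qed.

Lemma dotC u v : dot u v = conjc (dot v u).
Proof.
rewrite !dotE -csum_conj; last exact: dot_summable.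
by congr csum; apply/funext => i; rewrite conjcM conjcK mulrC.
Qed.

Lemma dotDr u v w : dot u (v + w) = dot u v + dot u w.
Proof. by rewrite dotC dotDl conjcD -!dotC. Qed.

Lemma dotZr c u v : dot u (c *: v) = conjc c * dot u v.
Proof. by rewrite dotC dotZl conjcM -dotC. Qed.

Lemma dot0l u : dot 0 u = 0.
Proof. by have := dotZl 0 0 u; rewrite scale0r mul0r. Qed.

Lemma dot0r u : dot u 0 = 0.
Proof. by rewrite dotC dot0l conjc0. Qed.

Lemma dotNl u v : dot (- u) v = - dot u v.
Proof. by rewrite -scaleN1r dotZl mulN1r. Qed.

Lemma dotBl u v w : dot (u - v) w = dot u w - dot v w.
Proof. by rewrite dotDl dotNl. Qed.

Lemma dotBr u v w : dot u (v - w) = dot u v - dot u w.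
Proof. by rewrite dotC dotBl conjcB -!dotC. Qed.

Lemma dot_suml (I : Type) (r : seq I) (P : pred I) (F : I -> H) v :
  dot (\sum_(i <- r | P i) F i) v = \sum_(i <- r | P i) dot (F i) v.
Proof.
elim/big_rec2: _ => [|i x y _ <-]; first exact: dot0l.
by rewrite dotDl.
Qed.

Lemma dot_sumr (I : Type) (r : seq I) (P : pred I) (F : I -> H) v :
  dot v (\sum_(i <- r | P i) F i) = \sum_(i <- r | P i) dot v (F i).
Proof.
by rewrite dotC dot_suml conjc_sum; apply: eq_bigr => i _; rewrite -dotC.
Qed.

Lemma dot_unitr u n : dot u (unit_vec n) = u n.
Proof.
rewrite dotE (@csum_finite _ _ n.+1).
  rewrite big_nat_recr //= eqxx conjc1 mulr1 big_nat_cond big1 ?add0r //.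
  by move=> i /andP[/andP[_ /ltn_eqF ->] _]; rewrite conjc0 mulr0.
by move=> i ni; rewrite /= (gtn_eqF ni) conjc0 mulr0.
Qed.

Lemma dot_self u : dot u u = (l2norm u ^+ 2)%:C%C.
Proof.
have cv : cvgn (series (fun i => nc (u i) ^+ 2)).
  apply: (@bounded_nnseries_cvg _ _ (l2norm u ^+ 2)) => [i|n]; first exact: sqr_ge0.
  exact: partial_le_l2norm.
rewrite /dot; under eq_fun do rewrite mul_conjc /=.
congr Complex; last first.
  under eq_fun do rewrite mul_conjc /=.
  by rewrite (@limn_series_finite _ _ 0) // big_nil.
apply: EFin_inj; rewrite l2norm_sqr -EFin_lim //.
have -> // : EFin \o series (fun x => nc (u x) ^+ 2) =
    (fun n => \sum_(0 <= i < n) (nc (u i) ^+ 2)%:E)%E.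
by apply/funext => n /=; rewrite seriesEnat /= -sumEFin.
Qed.

Lemma dot_nondeg u : (forall v, dot u v = 0) -> u = 0.
Proof. by move=> h; apply: ell2_ext => i; rewrite -dot_unitr h. Qed.

Lemma dot_inj u v : (forall w, dot w u = dot w v) -> u = v.
Proof.
move=> h; apply/eqP; rewrite -subr_eq0; apply/eqP; apply: dot_nondeg => w.
by rewrite dotC dotBr h subrr conjc0.
Qed.

Lemma l2norm_eq0 u : l2norm u = 0 -> u = 0.
Proof.
move=> h; apply: ell2_ext => i; apply: Normc.eq0_normc; apply/eqP.
by rewrite eq_le normc_ge0 andbT -h coord_le_l2norm.
Qed.

Lemma l2norm0 : l2norm (0 : H) = 0.
Proof.
apply/eqP; rewrite -sqrf_eq0; apply/eqP.
by have := dot_self 0; rewrite dot0l => /(congr1 (@CRe R)).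
Qed.

Lemma Re_dot_self u : CRe (dot u u) = l2norm u ^+ 2.
Proof. by rewrite dot_self. Qed.

Lemma l2normZ c u : l2norm (c *: u) = nc c * l2norm u.
Proof.
apply/eqP; rewrite -(@eqrXn2 _ 2) ?mulr_ge0 ?normc_ge0 //; apply/eqP.
rewrite -Re_dot_self dotZl dotZr dot_self mulrA mul_conjc exprMn.
by rewrite Re_rscale.
Qed.

Lemma cauchy_schwarz u v : nc (dot u v) <= l2norm u * l2norm v.
Proof.
have [v0|v0] := eqVneq (l2norm v) 0.
  by rewrite (l2norm_eq0 v0) dot0r Normc.normc0 mulr_ge0.
have vp : 0 < l2norm v by rewrite lt_def v0 l2norm_ge0.
apply: ler_sqr_pos; first by rewrite mulr_ge0.
(* The square norm of ||v||^2 u - <u, v> v is nonnegative; this multiple of the usual projection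
   residue avoids a division. *)
pose a := (l2norm v ^+ 2)%:C%C; pose b := dot u v.
have : 0 <= CRe (dot (a *: u - b *: v) (a *: u - b *: v)).
  by rewrite Re_dot_self sqr_ge0.
rewrite dotBl !dotBr !dotZl !dotZr (dotC v u) -/b !dot_self -/a.
have -> : conjc a = a by exact: conjc_real.
set U := (l2norm u ^+ 2)%:C%C.
have -> : a * (a * U) - a * (conjc b * b) - (b * (a * conjc b) - b * (conjc b * a))
  = a * (a * U - b * conjc b) by ring.
rewrite mul_conjc Re_rscale pmulr_rge0 ?exprn_gt0 //.
by rewrite ReB Re_rscale /= subr_ge0 exprMn mulrC.
Qed.

Lemma l2norm_triangle u v : l2norm (u + v) <= l2norm u + l2norm v.
Proof.
apply: ler_sqr_pos; first by rewrite addr_ge0.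
rewrite -(Re_dot_self (u + v)) dotDl !dotDr !ReD (Re_dot_self u) (Re_dot_self v) (dotC v u).
have -> : CRe (conjc (dot u v)) = CRe (dot u v) by case: (dot u v).
have := cauchy_schwarz u v; have := normc_Re (dot u v).
rewrite ler_norml => /andP[_ h1] h2; have := le_trans h1 h2; nra.
Qed.

Lemma l2normN u : l2norm (- u) = l2norm u.
Proof. by rewrite -scaleN1r l2normZ normc_opp Normc.normc1 mul1r. Qed.

End Ell2Space.
#[export] Hint Resolve l2norm_ge0 : core.

(* Keeps unification from unfolding these when it compares two vectors. *)
Opaque l2norm dot.

(** * Completeness and orthonormal bases *)

Section Hilbert.
Context {R : realType}.
Local Notation H := (ell2 R).
Implicit Types (u v w : H) (c : R[i]) (e : nat -> H).
Local Notation nc := (@Normc.normc R).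
Local Notation CRe := (@complex.Re R).
Local Notation CIm := (@complex.Im R).

Lemma cauchy_seq_cvg (x : nat -> R) :
  (forall e : R, 0 < e -> exists n, forall k, (n <= k)%N -> `|x k - x n| <= e) ->
  cvgn x.
Proof.
move=> h; apply/cauchy_cvgP/cauchy_exP => e e0.
have [n hn] := h (e / 2) (divr_gt0 e0 (ltr0n _ 2)).
exists (x n); exists n => // k /= /hn hk.
rewrite /ball /= distrC; apply: le_lt_trans hk _; lra.
Qed.

Lemma ell2_complete (s : nat -> H) :
  (forall e : R, 0 < e -> exists n, forall k, (n <= k)%N -> l2norm (s k - s n) <= e) ->
  exists w, forall e : R, 0 < e ->
    exists n, forall k, (n <= k)%N -> l2norm (s k - w) <= e.
Proof.
move=> cs.
have cRe i : cvgn (fun k => CRe (s k i)).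
  apply: cauchy_seq_cvg => e /cs[n hn]; exists n => k /hn; apply: le_trans.
  rewrite -ReB -ell2B; apply: le_trans (normc_Re _) _; exact: coord_le_l2norm.
have cIm i : cvgn (fun k => CIm (s k i)).
  apply: cauchy_seq_cvg => e /cs[n hn]; exists n => k /hn; apply: le_trans.
  rewrite -ImB -ell2B; apply: le_trans (normc_Im _) _; exact: coord_le_l2norm.
pose w i := Complex (limn (fun k => CRe (s k i))) (limn (fun k => CIm (s k i))).
(* Fatou's argument: a bound on finitely many coordinates is a closed condition, so it passes to the
   coordinatewise limit with a constant that does not depend on the number of coordinates. *)
have lim_bound u (B : R) n0 : 0 <= B -> (forall j, (n0 <= j)%N -> l2norm (u - s j) <= B) ->
    forall N, \sum_(0 <= i < N) nc (u i - w i) ^+ 2 <= B ^+ 2.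
  move=> B0 hB N.
  have cv : \sum_(0 <= i < N) ((CRe (u i) - CRe (s j i)) ^+ 2 +
        (CIm (u i) - CIm (s j i)) ^+ 2) @[j --> \oo] -->
      \sum_(0 <= i < N) ((CRe (u i) - CRe (w i)) ^+ 2 + (CIm (u i) - CIm (w i)) ^+ 2).
    apply: cvg_big => [|i _]; first exact: add_continuous.
    have cst (a : R) : (fun=> a) @ \oo --> a by exact: cvg_cst.
    have cr : CRe (u i) - CRe (s j i) @[j --> \oo] --> CRe (u i) - CRe (w i).
      exact: (cvgB (cst _) (cRe i)).
    have ci : CIm (u i) - CIm (s j i) @[j --> \oo] --> CIm (u i) - CIm (w i).
      exact: (cvgB (cst _) (cIm i)).
    by apply: cvgD; rewrite expr2; under eq_fun do rewrite expr2; apply: cvgM.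
  under eq_bigr do rewrite normc_sqr ReB ImB.
  apply: (cvgr_to_le cv); exists n0 => // j /= /hB hj.
  under eq_bigr do rewrite -ReB -ImB -normc_sqr.
  apply: le_trans (partial_le_l2norm (u - s j) N) _.
  by apply: lerXn2r; rewrite ?nnegrE ?l2norm_ge0.
have wl : w \in sqsummable.
  have [n hn] := cs 1 ltr01.
  have dl : (fun i => s n i - w i) \in sqsummable.
    apply: (@sqsummable_le _ _ (1 ^+ 2)); apply: (lim_bound (s n) 1 n) => // j nj.
    by rewrite -l2normN opprB hn.
  have -> : w = (-1) *: ((fun i => s n i - w i) : nat -> R[i]) + (s n : nat -> R[i]).
    by apply/funext => i; rewrite !fctE scaleN1r opprB subrK.
  by apply: sqsummable_lin => //; exact: ell2P.
exists (Ell2 wl) => e e0.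
have [n hn] := cs (e / 2) (divr_gt0 e0 (ltr0n _ 2)).
exists n => k nk; apply: ler_sqr_pos; first exact: ltW.
apply: l2norm_sqr_le; apply: (lim_bound (s k) e n); first exact: ltW.
move=> j nj; have -> : s k - s j = (s k - s n) + - (s j - s n).
  by rewrite opprB addrA subrK.
apply: le_trans (l2norm_triangle _ _) _; rewrite l2normN.
by rewrite [e]splitr lerD ?hn.
Qed.

Definition orthonormal e : Prop := forall i j, dot (e i) (e j) = (i == j)%:R.

Lemma l2norm_orthonormal e i : orthonormal e -> l2norm (e i) = 1.
Proof.
move=> oe; apply/eqP; rewrite -(@eqrXn2 _ 2) ?l2norm_ge0 //; apply/eqP.
by rewrite -Re_dot_self oe eqxx expr1n.
Qed.

Lemma dot_orthonormal_sum e (c : nat -> R[i]) m n k : orthonormal e ->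
  dot (\sum_(m <= i < n) c i *: e i) (e k) = if (m <= k < n)%N then c k else 0.
Proof.
move=> oe; rewrite dot_suml; under eq_bigr do rewrite dotZl oe.
case: ifPn => [hk|hk].
  rewrite (bigD1_seq k) ?mem_index_iota ?iota_uniq //= eqxx mulr1 big1 ?addr0 //.
  by move=> i /negPf ->; rewrite mulr0.
rewrite big_nat_cond big1 // => i /andP[hi _].
by have [ik|_] := eqVneq i k; rewrite ?mulr0 //; rewrite -ik hi in hk.
Qed.

Lemma pythagoras e (c : nat -> R[i]) m n : orthonormal e ->
  l2norm (\sum_(m <= i < n) c i *: e i) ^+ 2 = \sum_(m <= i < n) nc (c i) ^+ 2.
Proof.
move=> oe; rewrite -Re_dot_self dot_sumr.
rewrite (eq_big_nat _ _ (F2 := fun i => (nc (c i) ^+ 2)%:C%C)).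
  by elim/big_rec2: _ => // i x y _ <-; rewrite ReD.
by move=> i hi; rewrite dotZr dot_orthonormal_sum // hi mulrC mul_conjc.
Qed.

(** Completeness enters here: the partial sums are Cauchy by Pythagoras. This is the source of every
    vector given by its coordinates, in expansions, adjoints and diagonal operators. *)
Lemma riesz_fischer e (c : nat -> R[i]) (B : R) : orthonormal e -> 0 <= B ->
  (forall n, \sum_(0 <= i < n) nc (c i) ^+ 2 <= B ^+ 2) ->
  exists w, [/\ forall i, dot w (e i) = c i, l2norm w <= B &
    forall eps : R, 0 < eps ->
      exists n, l2norm (w - \sum_(0 <= i < n) c i *: e i) <= eps].
Proof.
move=> oe B0 cB; pose s n := \sum_(0 <= i < n) c i *: e i.
have sq0 i : 0 <= nc (c i) ^+ 2 by exact: sqr_ge0.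
have cv : cvgn (series (fun i => nc (c i) ^+ 2)) by apply: bounded_nnseries_cvg cB.
have sB n : l2norm (s n) <= B.
  by apply: ler_sqr_pos => //; rewrite pythagoras.
have [|w hw] := @ell2_complete s.
  move=> eps eps0.
  have /cauchy_cvgP/cauchy_seriesP/(_ _ (exprn_gt0 2 eps0)) := cv.
  case=> -[P Q] /= [[n1 _ hP] [n2 _ hQ]] hPQ; exists (maxn n1 n2) => k nk.
  apply: ler_sqr_pos; first exact: ltW.
  have -> : s k - s (maxn n1 n2) = \sum_(maxn n1 n2 <= i < k) c i *: e i.
    by apply/eqP; rewrite subr_eq addrC -big_cat_nat.
  rewrite pythagoras //; apply: le_trans (ler_norm _) _; apply: ltW.
  apply: (hPQ (maxn n1 n2, k)); split; first by apply: hP => /=; exact: leq_maxl.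
  by apply: hQ => /=; apply: leq_trans nk; exact: leq_maxr.
have small (x : R) : 0 <= x -> (forall eps : R, 0 < eps -> x <= eps) -> x = 0.
  move=> x0 h; apply/eqP; rewrite eq_le x0 andbT; apply/ler_addgt0Pl => eps /h.
  by rewrite addr0.
exists w; split => [i||eps /hw[n hn]]; last first.
- by exists n; rewrite -l2normN opprB hn.
- apply/ler_addgt0Pl => eps /hw[n /(_ n (leqnn n)) hn].
  have -> : w = - (s n - w) + s n by rewrite opprB subrK.
  apply: le_trans (l2norm_triangle _ _) _; rewrite l2normN.
  by apply: lerD.
apply/eqP; rewrite -subr_eq0; apply/eqP/Normc.eq0_normc.
apply: small => [|eps /hw[n hn]]; first exact: normc_ge0.
have := hn (maxn n i.+1) (leq_maxl _ _); apply: le_trans.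
have <- : dot (s (maxn n i.+1)) (e i) = c i.
  by rewrite dot_orthonormal_sum //= leq_maxr.
rewrite -dotBl; apply: le_trans (cauchy_schwarz _ _) _.
by rewrite (l2norm_orthonormal _ oe) mulr1 -l2normN opprB.
Qed.

Lemma bessel e u n : orthonormal e ->
  \sum_(0 <= i < n) nc (dot u (e i)) ^+ 2 <= l2norm u ^+ 2.
Proof.
move=> oe; pose s := \sum_(0 <= i < n) dot u (e i) *: e i.
have du : dot u s = (\sum_(0 <= i < n) nc (dot u (e i)) ^+ 2)%:C%C.
  rewrite dot_sumr rmorph_sum; apply: eq_bigr => i _ /=.
  by rewrite dotZr mulrC mul_conjc.
have : 0 <= CRe (dot (u - s) (u - s)) by rewrite Re_dot_self sqr_ge0.
rewrite dotBl !dotBr (dotC s u) du (dot_self s) pythagoras //.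
rewrite conjc_real subrr subr0 ReB Re_dot_self /=; lra.
Qed.

Lemma basis_eq e u v : orthonormal_basis e ->
  (forall i, dot u (e i) = dot v (e i)) -> u = v.
Proof.
move=> [_ ce] uv; apply/eqP; rewrite -subr_eq0; apply/eqP/ce => i.
by rewrite dotBl uv subrr.
Qed.

(** Riesz-Fischer produces the sum of the Fourier series of [u]. It has the same coefficients as
    [u], and totality of [e] makes the two equal. *)
Lemma basis_expansion e u : orthonormal_basis e -> forall eps : R, 0 < eps ->
  exists n, l2norm (u - \sum_(0 <= i < n) dot u (e i) *: e i) <= eps.
Proof.
move=> [oe ce].
have [//|w [wc _ wl]] := @riesz_fischer e (fun i => dot u (e i)) (l2norm u) oe (l2norm_ge0 u).
  by move=> n; exact: bessel.
have uw : u = w by apply: (basis_eq (conj oe ce)) => i; rewrite wc.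
by move=> eps /wl[n hn]; exists n; rewrite {1}uw.
Qed.

(** Finite combinations of [e] are dense and [phi] is continuous. Identities between bounded
    operators are thereby reduced to a basis. *)
Lemma basis_ext e (phi : H -> R[i]) (K : R) : orthonormal_basis e ->
  (forall c u v, phi (c *: u + v) = c * phi u + phi v) ->
  (forall u, nc (phi u) <= K * l2norm u) ->
  (forall i, phi (e i) = 0) -> forall u, phi u = 0.
Proof.
move=> be lphi bphi ephi u.
have K0 : 0 <= K.
  have := le_trans (normc_ge0 _) (bphi (e 0%N)); by rewrite l2norm_orthonormal ?mulr1 //; case: be.
have phi0 : phi 0 = 0.
  have := lphi 0 0 0; rewrite scale0r addr0 mul0r add0r => h; have := lphi 1 0 0.
  by rewrite scale1r addr0 mul1r -[X in X = _]addr0 => /addrI.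
have phis n (c : nat -> R[i]) : phi (\sum_(0 <= i < n) c i *: e i) = 0.
  by elim/big_rec: _ => // i x _ hx; rewrite lphi ephi hx mulr0 addr0.
apply: Normc.eq0_normc; apply/eqP; rewrite eq_le normc_ge0 andbT; apply/ler_addgt0Pl => eps eps0.
(* [K] may be 0, hence the division by [K + 1]. *)
have K1 : 0 < K + 1 by apply: ltr_wpDl.
have [n hn] := basis_expansion u be (divr_gt0 eps0 K1).
set s := \sum_(0 <= i < n) _ in hn.
have -> : phi u = phi (u - s).
  have := lphi (-1) s u; rewrite phis mulr0 add0r => <-.
  by rewrite scaleN1r addrC.
rewrite addr0; apply: le_trans (bphi _) _.
apply: (le_trans (ler_wpM2l K0 hn)); rewrite mulrA ler_pdivrMr //.
by rewrite mulrC ler_wpM2l ?lerDl // ltW.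
Qed.

End Hilbert.

(** * Bounded operators *)

Section Operators.
Context {R : realType}.
Local Notation H := (ell2 R).
Implicit Types (u v w : H) (c : R[i]) (e : nat -> H) (A B S T : H -> H).
Local Notation nc := (@Normc.normc R).
Local Notation CRe := (@complex.Re R).

Lemma unit_basis : orthonormal_basis (@unit_vec R).
Proof.
split=> [i j|u h]; first by rewrite dot_unitr /= eq_sym.
by apply: ell2_ext => i; rewrite -dot_unitr h.
Qed.

Lemma bounded_opL A : bounded_op A -> forall c u v, A (c *: u + v) = c *: A u + A v.
Proof. by case. Qed.

Lemma bounded_op0 A : bounded_op A -> A 0 = 0.
Proof.
by move=> hA; have := bounded_opL hA (-1) 0 0; rewrite scaler0 addr0 scaleN1r addNr.
Qed.

Lemma bounded_op_sum A (I : Type) (r : seq I) (c : I -> R[i]) (f : I -> H) : bounded_op A ->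
  A (\sum_(i <- r) c i *: f i) = \sum_(i <- r) c i *: A (f i).
Proof.
move=> hA; elim/big_rec2: _ => [|i x y _ <-]; first exact: bounded_op0.
exact: bounded_opL.
Qed.

Lemma bounded_op_bound A : bounded_op A ->
  exists K : R, 0 <= K /\ forall u, l2norm (A u) <= K * l2norm u.
Proof.
case=> _ [K hK]; exists (Num.max K 0); split; first by rewrite le_max lexx orbT.
by move=> u; apply: le_trans (hK u) _; rewrite ler_wpM2r ?l2norm_ge0 // le_max lexx.
Qed.

Lemma bounded_op_comb A B c : bounded_op A -> bounded_op B ->
  bounded_op (fun u => c *: A u + B u).
Proof.
move=> hA hB; split=> [a u v|].
  rewrite (bounded_opL hB) (bounded_opL hA) scalerDr scalerDr !scalerA (mulrC c).
  by rewrite addrACA.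
have [K [K0 hK]] := bounded_op_bound hA; have [L [L0 hL]] := bounded_op_bound hB.
exists (nc c * K + L) => u; apply: le_trans (l2norm_triangle _ _) _.
rewrite l2normZ mulrDl -mulrA lerD // ler_wpM2l // normc_ge0 //.
Qed.

Lemma bounded_op_id : bounded_op (id : H -> H).
Proof. by split=> //; exists 1 => u; rewrite mul1r. Qed.

Lemma bounded_op_dot A v : bounded_op A ->
  exists K, forall u, nc (dot (A u) v) <= K * l2norm u.
Proof.
move=> /bounded_op_bound[K [K0 hK]]; exists (K * l2norm v) => u.
apply: le_trans (cauchy_schwarz _ _) _.
by rewrite mulrAC ler_wpM2r ?l2norm_ge0.
Qed.

(** With [B] the identity and two different vectors [v] and [v'], this establishes adjoint relations
    by a check on a basis. *)
Lemma bounded_op_dot_ext e A B v v' : orthonormal_basis e ->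
  bounded_op A -> bounded_op B ->
  (forall i, dot (A (e i)) v = dot (B (e i)) v') -> forall u, dot (A u) v = dot (B u) v'.
Proof.
move=> be hA hB h u; apply/eqP; rewrite -subr_eq0; apply/eqP.
have [K hK] := bounded_op_dot v hA; have [L hL] := bounded_op_dot v' hB.
apply: (@basis_ext _ e (fun u => dot (A u) v - dot (B u) v') (K + L)) => //.
- move=> c x y; rewrite (bounded_opL hA) (bounded_opL hB) !dotDl !dotZl; ring.
- move=> x; apply: le_trans (normc_triangle _ _) _; rewrite normc_opp mulrDl.
  exact: lerD.
- by move=> i; rewrite h subrr.
Qed.

Lemma bounded_op_ext e A B : orthonormal_basis e -> bounded_op A -> bounded_op B ->
  (forall i, A (e i) = B (e i)) -> A = B.
Proof.
move=> be hA hB h; apply/funext => u; apply/eqP; rewrite -subr_eq0; apply/eqP.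
apply: dot_nondeg => v; rewrite dotBl; apply/eqP; rewrite subr_eq0; apply/eqP.
by apply: (bounded_op_dot_ext be hA hB) => i; rewrite h.
Qed.

Lemma bounded_op_entry_ext A B : bounded_op A -> bounded_op B ->
  (forall i j, dot (A (unit_vec i)) (unit_vec j) = dot (B (unit_vec i)) (unit_vec j)) ->
  A = B.
Proof.
move=> hA hB h; apply: (bounded_op_ext unit_basis hA hB) => i.
by apply: (basis_eq unit_basis) => j; rewrite h.
Qed.

(** Riesz representation. The only candidate has coordinates conj <A e_i, v>. Its truncation w
    satisfies ||w||^2 = <A w, v> <= ||w|| K ||v||, so the coordinates are square summable. *)
Lemma adjoint_exists A : bounded_op A -> exists B, forall u v, dot (A u) v = dot u (B v).
Proof.
move=> hA; have [K [K0 hK]] := bounded_op_bound hA.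
suff h v : exists w, forall u, dot (A u) v = dot u w.
  by have [B hB] := choice h; exists B.
pose c i := conjc (dot (A (unit_vec i)) v).
have [ob _] := unit_basis.
have [| |w [wc _ _]] := @riesz_fischer _ (@unit_vec R) c (K * l2norm v) ob.
- by rewrite mulr_ge0 // l2norm_ge0.
- move=> n; set s := \sum_(0 <= i < n) _.
  pose w := \sum_(0 <= i < n) c i *: unit_vec i : H.
  have ws : l2norm w ^+ 2 = s by rewrite /w pythagoras.
  have Aw : dot (A w) v = s%:C%C.
    rewrite /w bounded_op_sum // dot_suml rmorph_sum; apply: eq_bigr => i _ /=.
    by rewrite dotZl -mul_conjc /c conjcK.
  have := cauchy_schwarz (A w) v; rewrite Aw normc_real -ws ger0_norm ?sqr_ge0 // => h.
  have {h}h : l2norm w ^+ 2 <= l2norm w * (K * l2norm v).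
    apply: le_trans h _; rewrite mulrA (mulrC (l2norm w)) ler_wpM2r ?l2norm_ge0 //.
  have w0 := l2norm_ge0 w; have v0 : 0 <= K * l2norm v by rewrite mulr_ge0 // l2norm_ge0.
  apply: lerXn2r; rewrite ?nnegrE //.
  have [->//|wn] := eqVneq (l2norm w) 0.
  by rewrite expr2 ler_pM2l // lt_def wn in h.
exists w => u; apply: (bounded_op_dot_ext unit_basis hA bounded_op_id) => i.
by rewrite [RHS]dotC wc conjcK.
Qed.

(** [adjop] is a choice, but nondegeneracy of [dot] leaves a single candidate, so exhibiting an
    adjoint computes it. *)
Lemma adjopP A B : (forall u v, dot (A u) v = dot u (B v)) -> adjop A = B.
Proof.
move=> hB; rewrite /adjop; case: xgetP => [C _ hC|/(_ B)] //.
apply/funext => v; apply: dot_inj => u.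
by rewrite -(hC u v) -hB.
Qed.

Lemma dot_adjop A u v : bounded_op A -> dot (A u) v = dot u (adjop A v).
Proof. by move=> /adjoint_exists[B hB]; rewrite (adjopP hB). Qed.

Lemma dot_sqabs A u v : bounded_op A -> dot (sqabs A u) v = dot (A u) (A v).
Proof. by move=> hA; rewrite dotC [RHS]dotC /sqabs /= -dot_adjop. Qed.

Lemma Re_dot_sqabs A u : bounded_op A -> CRe (dot (sqabs A u) u) = l2norm (A u) ^+ 2.
Proof. by move=> hA; rewrite dot_sqabs // Re_dot_self. Qed.

(** Supplies |A|^p in [schatten_entry], where A is not a finite matrix. Multiplying the coordinates
    by a bounded sequence keeps them square summable, by Bessel's inequality. *)
Lemma diag_op_exists e (lam : nat -> R) (K : R) : orthonormal_basis e ->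
  (forall i, 0 <= lam i <= K) ->
  exists S, bounded_op S /\ forall i, S (e i) = (lam i)%:C%C *: e i.
Proof.
move=> be hl; have [oe _] := be.
have K0 : 0 <= K by have /andP[/le_trans] := hl 0%N; apply.
have h u : exists w, (forall i, dot w (e i) = (lam i)%:C%C * dot u (e i)) /\
    l2norm w <= K * l2norm u.
  have [| |w [wc wK _]] := @riesz_fischer _ e (fun i => (lam i)%:C%C * dot u (e i))
    (K * l2norm u) oe.
  - by rewrite mulr_ge0 ?l2norm_ge0.
  - move=> n; rewrite exprMn.
    apply: (@le_trans _ _ (K ^+ 2 * \sum_(0 <= i < n) nc (dot u (e i)) ^+ 2)).
      rewrite mulr_sumr; apply: ler_sum => i _; rewrite Normc.normcM normc_real exprMn.
      have /andP[l0 lK] := hl i; rewrite (ger0_norm l0).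
      by rewrite ler_wpM2r ?sqr_ge0 //; apply: lerXn2r; rewrite ?nnegrE.
    by rewrite ler_wpM2l ?sqr_ge0 // bessel.
  by exists w.
have [S hS] := choice h; exists S; split; last first.
  move=> i; apply: (basis_eq be) => j; rewrite (hS _).1 dotZl oe.
  by case: eqVneq => [->//|]; rewrite !mulr0.
split; last by exists K => u; exact: (hS u).2.
move=> c u v; apply: (basis_eq be) => j.
rewrite dotDl dotZl !(hS _).1 dotDl dotZl; ring.
Qed.

(** Clear on finite combinations of [e]. For a partial sum s of u, <S u, u> = <S (u - s), u> + <S s,
    u - s> + <S s, s>, where the first two terms are small. *)
Lemma diag_op_pos e (lam : nat -> R) S u : orthonormal_basis e -> bounded_op S ->
  (forall i, 0 <= lam i) -> (forall i, S (e i) = (lam i)%:C%C *: e i) ->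
  0 <= CRe (dot (S u) u).
Proof.
move=> be hS l0 Se; have [oe _] := be; have [K [K0 hK]] := bounded_op_bound hS.
have Ssum n (c : nat -> R[i]) :
    0 <= CRe (dot (S (\sum_(0 <= i < n) c i *: e i)) (\sum_(0 <= i < n) c i *: e i)).
  have -> : S (\sum_(0 <= i < n) c i *: e i) =
      \sum_(0 <= i < n) (c i * (lam i)%:C%C) *: e i.
    by rewrite bounded_op_sum //; apply: eq_bigr => i _; rewrite Se scalerA.
  rewrite dot_sumr; rewrite (eq_big_nat _ _
    (F2 := fun i => (lam i * nc (c i) ^+ 2)%:C%C)); last first.
    move=> i hi; rewrite dotZr dot_orthonormal_sum // hi mulrA (mulrC (conjc _)).
    by rewrite mul_conjc -rmorphM mulrC.
  elim/big_rec: _ => // i x _ hx; rewrite ReD addr_ge0 //.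
  by rewrite mulr_ge0 ?sqr_ge0.
apply/ler_addgt0Pl => eps eps0; rewrite addrC.
(* Each error term is at most K ||u|| eps / D, so together they stay below eps; the summand 1 keeps
   D positive. *)
pose D := K * (l2norm u + l2norm u) + 1.
have D0 : 0 < D by rewrite ltr_wpDl // mulr_ge0 // addr_ge0 ?l2norm_ge0.
have [n hn] := basis_expansion u be (divr_gt0 eps0 D0).
set s := \sum_(0 <= i < n) _ in hn.
have su : l2norm s <= l2norm u.
  by apply: ler_sqr_pos (l2norm_ge0 _) _; rewrite pythagoras // bessel.
have Sus : S u = S (u - s) + S s.
  by have := bounded_opL hS 1 (u - s) s; rewrite !scale1r subrK.
have -> : dot (S u) u = dot (S (u - s)) u + dot (S s) (u - s) + dot (S s) s.
  by rewrite -addrA -dotDr subrK -dotDl -Sus.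
rewrite !ReD; have := Ssum n (fun i => dot u (e i)); rewrite -/s.
have h1 : - (K * (eps / D) * l2norm u) <= CRe (dot (S (u - s)) u).
  have := normc_Re (dot (S (u - s)) u); rewrite ler_norml => /andP[+ _].
  apply: le_trans; rewrite lerN2; apply: le_trans (cauchy_schwarz _ _) _.
  rewrite ler_wpM2r ?l2norm_ge0 //; apply: le_trans (hK _) _.
  by rewrite ler_wpM2l.
have h2 : - (K * l2norm u * (eps / D)) <= CRe (dot (S s) (u - s)).
  have := normc_Re (dot (S s) (u - s)); rewrite ler_norml => /andP[+ _].
  apply: le_trans; rewrite lerN2; apply: le_trans (cauchy_schwarz _ _) _.
  rewrite ler_pM ?l2norm_ge0 //; apply: le_trans (hK _) _.
  by rewrite ler_wpM2l.
have h3 : K * (eps / D) * l2norm u + K * l2norm u * (eps / D) <= eps.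
  rewrite (_ : _ + _ = eps * (K * (l2norm u + l2norm u)) / D); last by rewrite -!mulrA; ring.
  rewrite ler_pdivrMr //.
  by apply: ler_wpM2l; [exact: ltW|rewrite /D lerDl].
move: h1 h2 h3.
move: (CRe _) (CRe _) (CRe _) (K * _ * _) (K * _ * _) => x1 x2 x3 x4 x5; lra.
Qed.

End Operators.

(** * The Schatten norm *)

Section Schatten.
Context {R : realType}.
Local Notation H := (ell2 R).
Implicit Types (u v w : H) (c : R[i]) (e : nat -> H) (A B S T : H -> H) (a p q : R).
Local Notation nc := (@Normc.normc R).
Local Notation CRe := (@complex.Re R).

(** Self-adjointness of an operator with real eigenvalues: both sides are bounded functionals of
    [u], so they are compared on [e]. *)
Lemma diag_op_dot e (lam : nat -> R) S u j : orthonormal_basis e -> bounded_op S ->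
  (forall i, S (e i) = (lam i)%:C%C *: e i) ->
  dot (S u) (e j) = (lam j)%:C%C * dot u (e j).
Proof.
move=> be hS Se; have oe := be.1.
rewrite (bounded_op_dot_ext be hS bounded_op_id (v' := (lam j)%:C%C *: e j)).
  by rewrite dotZr conjc_real.
move=> i; rewrite Se dotZl dotZr conjc_real oe.
by have [->|_] := eqVneq i j; rewrite ?mulr0.
Qed.

(** The eigenbases e and f may differ, but <f_i, e_j> != 0 forces the eigenvalues of f_i and e_j to
    coincide, hence also their powers. *)
Lemma is_opow_unique T a S S' : is_opow T a S -> is_opow T a S' -> S = S'.
Proof.
move=> [hT hS [e [lam [be he]]]] [_ hS' [f [mu [bf hf]]]].
apply: (bounded_op_ext bf hS hS') => i; apply: (basis_eq be) => j.
have [_ Tf ->] := hf i.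
have hTe k : T (e k) = (lam k)%:C%C *: e k by have [] := he k.
have hSe k : S (e k) = (lam k `^ a)%:C%C *: e k by have [] := he k.
rewrite (diag_op_dot _ _ be hS hSe) dotZl.
have := diag_op_dot (f i) j be hT hTe; rewrite Tf dotZl.
have [->|d0] := eqVneq (dot (f i) (e j)) 0; first by rewrite !mulr0.
by move/(mulIf d0) => [->].
Qed.

Lemma opowE T a S : is_opow T a S -> opow T a = S.
Proof.
by move=> h; rewrite /opow; case: xgetP => [S' _ h'|/(_ S)]//; exact: is_opow_unique h' h.
Qed.

Lemma trace_ge T i : (forall u, 0 <= CRe (dot (T u) u)) ->
  ((CRe (dot (T (unit_vec i)) (unit_vec i)))%:E <= trace T)%E.
Proof.
move=> T0; have F0 n : (0 <= (CRe (dot (T (unit_vec n)) (unit_vec n)))%:E)%E.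
  by rewrite lee_fin.
apply: le_trans (nneseries_lim_ge i.+1 (fun n _ _ => F0 n)).
rewrite big_nat_recr //= leeDr //; apply: sume_ge0 => k _; exact: F0.
Qed.

(* Tangent line of the convex function [x `^ q] at [t]. *)
Lemma powR_tangent (x t q : R) : 1 < q -> 0 <= x -> 0 <= t ->
  q * t `^ (q - 1) * x <= x `^ q + (q - 1) * t `^ q.
Proof.
move=> q1 x0 t0; have q0 : 0 < q by apply: lt_trans q1.
(* Young's inequality for x and t^(q-1) with the conjugate exponents q and q / (q - 1), to be
   multiplied by q. *)
have := @conjugate_powR R x (t `^ (q - 1)) q (q / (q - 1)) x0 (powR_ge0 _ _) q0.
have qm : 0 < q - 1 by rewrite subr_gt0.
have qn : q - 1 != 0 by rewrite gt_eqF.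
have qn0 : q != 0 by rewrite gt_eqF.
rewrite divr_gt0 // -powRrM => /(_ isT).
have -> : (q - 1) * (q / (q - 1)) = q by rewrite mulrC divfK.
have -> : q^-1 + (q / (q - 1))^-1 = 1 by field; rewrite qn0 qn.
move/(_ erefl) => h.
have := ler_wpM2l (ltW q0) h.
have -> : q * (x `^ q / q + t `^ q / (q / (q - 1))) = x `^ q + (q - 1) * t `^ q.
  by field; rewrite qn0 qn.
by rewrite mulrA mulrAC.
Qed.

Lemma ge0_le_poweR (x y : \bar R) (r : R) : 0 <= r -> (0 <= x)%E -> (x <= y)%E ->
  (x `^ r <= y `^ r)%E.
Proof.
move=> r0 x0 xy; apply: (gt0_ler_poweR r0) => //; rewrite in_itv /= leey andbT //.
exact: le_trans xy.
Qed.

(* Jensen's inequality for the spectral measure of [A^* A] at a unit vector: with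
   [t = ||A e_i||^2] and [q = p / 2], the operator
   [|A|^p - q t^(q-1) |A|^2 + (q - 1) t^q] is positive. *)
Lemma schatten_entry A i p : 2 < p -> ((l2norm (A (unit_vec i)))%:E <= schatten p A)%E.
Proof.
move=> p2; have p0 : 0 < p by apply: lt_trans p2.
rewrite /schatten; case: asboolP => [[hA [S0 hS0]]|_]; last by rewrite leey.
rewrite /absop /sqrtop (opowE hS0).
case: hS0 => hsq hS0 [e [lam [be he]]].
pose mu n := lam n `^ 2^-1.
have S0e n : S0 (e n) = (mu n)%:C%C *: e n by have [] := he n.
have mu0 n : 0 <= mu n by exact: powR_ge0.
have [K [K0 hK]] := bounded_op_bound hS0.
have muK n : mu n <= K.
  have := hK (e n); rewrite S0e l2normZ normc_real (l2norm_orthonormal _ be.1) !mulr1.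
  by rewrite ger0_norm.
have [|S [hS Se]] := @diag_op_exists R e (fun n => mu n `^ p) (K `^ p) be.
  by move=> n; rewrite powR_ge0 /= ge0_ler_powR ?nnegrE // ltW.
rewrite (@opowE S0 p S); last by split => //; exists e, mu; split => // n; split.
set ui := unit_vec i.
pose t := l2norm (A ui) ^+ 2; pose q := p / 2.
have t0 : 0 <= t by exact: sqr_ge0.
have q1 : 1 < q by rewrite ltr_pdivlMr // mul1r.
have Spos : forall u, 0 <= CRe (dot (S u) u).
  by move=> u; apply: (diag_op_pos _ be hS _ Se) => n; exact: powR_ge0.
pose D u := (- (q * t `^ (q - 1)))%:C%C *: sqabs A u +
  (((q - 1) * t `^ q)%:C%C *: u + S u).
have hD : bounded_op D by do 2 apply: bounded_op_comb => //; exact: bounded_op_id.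
have muq n : mu n `^ p = lam n `^ q.
  by rewrite /mu -powRrM mulrC.
have : 0 <= CRe (dot (D ui) ui).
  apply: (diag_op_pos _ be hD (lam := fun n => - (q * t `^ (q - 1)) * lam n +
     ((q - 1) * t `^ q + mu n `^ p))) => n.
    have [l0 _ _] := he n; have := powR_tangent q1 l0 t0.
    rewrite muq -subr_ge0; congr (_ <= _); ring.
  have [_ sqe _] := he n.
  by rewrite /D sqe Se scalerA -!scalerDl !rmorphD !rmorphM.
rewrite /D !dotDl !dotZl !ReD !Re_rscale Re_dot_sqabs // Re_dot_self -/t.
rewrite (l2norm_orthonormal _ (@unit_basis R).1) expr1n mulr1.
have -> : - (q * t `^ (q - 1)) * t = - (q * t `^ q).
  rewrite mulNr -mulrA; congr (- (_ * _)).
  have [->|tn] := eqVneq t 0; first by rewrite mulr0 powR0 // gt_eqF // (lt_trans _ q1).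
  by rewrite -{2}(powRr1 t0) -powRD ?subrK // tn implybT.
move=> h; have {h}h : t `^ q <= CRe (dot (S ui) ui).
  rewrite -subr_ge0; apply: le_trans h _.
  by rewrite (_ : CRe _ - _ = - (q * t `^ q) + ((q - 1) * t `^ q + CRe (dot (S ui) ui))) //; ring.
have h2 : ((t `^ q)%:E <= trace S)%E.
  by apply: le_trans (trace_ge i Spos); rewrite lee_fin.
have pi0 : 0 <= p^-1 by rewrite invr_ge0 ltW.
have := ge0_le_poweR pi0 _ h2; rewrite lee_fin powR_ge0 => /(_ isT).
apply: le_trans; rewrite poweR_EFin lee_fin -powRrM /q mulrAC divff ?gt_eqF // mul1r.
by rewrite powR12_sqrt // sqrtr_sqr ler_norm.
Qed.

End Schatten.

(** * Finite matrices as operators *)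

Definition adjmx {R : realType} {a b : nat} (A : 'M[R[i]]_(a, b)) : 'M[R[i]]_(b, a) :=
  map_mx conjc A^T.

(** * Spectral decomposition of Gram matrices *)

Section Gram.
Context {R : realType}.
Local Notation C := R[i].
Local Notation nc := (@Normc.normc R).
Local Notation CRe := (@complex.Re R).

Lemma Re_sum (I : Type) (r : seq I) (P : pred I) (F : I -> C) :
  CRe (\sum_(i <- r | P i) F i) = \sum_(i <- r | P i) CRe (F i).
Proof. by elim/big_rec2: _ => // i x y _ <-; rewrite ReD. Qed.

Lemma adjmxE a b (A : 'M[C]_(a, b)) i j : adjmx A i j = conjc (A j i).
Proof. by rewrite !mxE. Qed.

Lemma adjmxK a b (A : 'M[C]_(a, b)) : adjmx (adjmx A) = A.
Proof. by apply/matrixP => i j; rewrite !adjmxE conjcK. Qed.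

Lemma adjmx_mul a b d (A : 'M[C]_(a, b)) (B : 'M[C]_(b, d)) :
  adjmx (A *m B) = adjmx B *m adjmx A.
Proof.
apply/matrixP => i j; rewrite adjmxE !mxE conjc_sum; apply: eq_bigr => k _.
by rewrite conjcM !adjmxE mulrC.
Qed.

Lemma adjmx_conjC a b (A : 'M[C]_(a, b)) : adjmx A = map_mx Num.conj A^T.
Proof. apply/matrixP => i j; rewrite !mxE; exact/esym/conjC_conjc. Qed.

Definition rdiag b (lam : 'I_b -> R) : 'M[C]_b := diag_mx (\row_j (lam j)%:C%C).

Lemma rdiagE b (lam : 'I_b -> R) i j : rdiag lam i j = (lam j)%:C%C *+ (i == j).
Proof. by rewrite !mxE; case: eqVneq => [->|]. Qed.

Lemma mul_rdiag b (lam mu : 'I_b -> R) :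
  rdiag lam *m rdiag mu = rdiag (fun j => lam j * mu j).
Proof.
rewrite /rdiag mulmx_diag; congr diag_mx; apply/rowP => j.
by rewrite !mxE rmorphM.
Qed.

Lemma adj_rdiag b (lam : 'I_b -> R) : adjmx (rdiag lam) = rdiag lam.
Proof.
apply/matrixP => i j; rewrite adjmxE !rdiagE eq_sym; case: eqVneq => [->|_].
  by rewrite !mulr1n conjc_real.
by rewrite !mulr0n conjc0.
Qed.

(** The eigenvectors are the columns of [adjmx U]. The eigenvalues are kept as nonnegative reals so
    that [powR] applies to them. *)
Definition spectral_form b (G U : 'M[C]_b) (lam : 'I_b -> R) : Prop :=
  [/\ U *m adjmx U = 1%:M, forall j, 0 <= lam j & G = adjmx U *m rdiag lam *m U].

(** The spectral theorem gives a complex diagonal. Conjugating by U exhibits it as the Gram matrix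
    of [A *m adjmx U], so its entries are square norms of columns. *)
Lemma gram_spectral a b (A : 'M[C]_(a, b)) :
  exists U lam, spectral_form (adjmx A *m A) U lam.
Proof.
set G := adjmx A *m A.
have Gadj : adjmx G = G by rewrite adjmx_mul adjmxK.
have /orthomx_spectralP : G \is normalmx.
  by apply/normalmxP; rewrite -adjmx_conjC Gadj.
rewrite invmx_unitary ?spectral_unitarymx // -adjmx_conjC.
set U := spectralmx G; set d := spectral_diag G => eG.
have UU : U *m adjmx U = 1%:M.
  by rewrite adjmx_conjC; apply/unitarymxP; exact: spectral_unitarymx.
have dE : diag_mx d = adjmx (A *m adjmx U) *m (A *m adjmx U).
  rewrite adjmx_mul adjmxK mulmxA -(mulmxA U) -/G eG !mulmxA UU mul1mx.
  by rewrite -mulmxA UU mulmx1.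
exists U, (fun j => \sum_k nc ((A *m adjmx U) k j) ^+ 2).
clearbody U d G; split; first exact: UU.
  by move=> j; apply: sumr_ge0 => k _; exact: sqr_ge0.
rewrite {1}eG; congr (_ *m _ *m _).
apply/matrixP => i j; rewrite rdiagE mxE.
have [->|//] := eqVneq i j; rewrite !mulr1n.
have := congr1 (fun X : 'M[C]_b => X j j) dE; rewrite mxE eqxx mulr1n => ->.
rewrite mxE rmorph_sum; apply: eq_bigr => k _ /=.
by rewrite adjmxE mulrC mul_conjc.
Qed.

Lemma spectral_sqr b (G U : 'M[C]_b) lam n : spectral_form G U lam ->
  G *m G = n%:C%C *: G -> forall j, lam j ^+ 2 = n * lam j.
Proof.
move=> [UU _ ->] h j.
have := congr1 (fun X => (U *m X *m adjmx U) j j) h.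
rewrite -scalemxAr -scalemxAl !mulmxA UU mul1mx -!(mulmxA _ U (adjmx U)) UU !mulmx1.
rewrite mul_rdiag [X in _ = X -> _]mxE !rdiagE eqxx !mulr1n => /(congr1 CRe).
by rewrite Re_rscale /=.
Qed.

Lemma spectral_trace b (G U : 'M[C]_b) lam : spectral_form G U lam ->
  \tr G = (\sum_j lam j)%:C%C.
Proof.
move=> [UU _ ->]; rewrite mxtrace_mulC mulmxA UU mul1mx rmorph_sum.
by apply: eq_bigr => j _; rewrite rdiagE eqxx.
Qed.

(** In the coordinates U v, the matrix acts diagonally; if no eigenvalue were c, every coordinate
    would vanish. *)
Lemma spectral_ge b (G U : 'M[C]_b) lam (v : 'cV[C]_b) (c : R) :
  spectral_form G U lam -> v != 0 -> G *m v = c%:C%C *: v -> exists j, lam j = c.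
Proof.
move=> [UU _ eG] v0 hv; apply/not_existsP => hl.
have UU' : adjmx U *m U = 1%:M by exact: mulmx1C.
have : rdiag lam *m (U *m v) = c%:C%C *: (U *m v).
  by rewrite scalemxAr -hv eG !mulmxA UU mul1mx.
move=> /matrixP h; case/eqP: v0; rewrite -[v]mul1mx -UU' -mulmxA.
suff -> : U *m v = 0 by rewrite mulmx0.
apply/matrixP => j k; rewrite [RHS]mxE; have := h j k.
rewrite mul_diag_mx !mxE => /eqP; rewrite -subr_eq0 -mulrBl mulf_eq0 => /orP[|/eqP //].
by rewrite subr_eq0 => /eqP[] /hl.
Qed.

End Gram.

(** * Matrices acting on l^2 and their Schatten norms *)

Section FiniteMatrices.
Context {R : realType}.
Local Notation C := R[i].
Local Notation H := (ell2 R).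
Local Notation nc := (@Normc.normc R).
Local Notation CRe := (@complex.Re R).

Definition ell2_col b (u : H) : 'cV[C]_b := \col_j u j.

Definition col_ell2 a (w : 'cV[C]_a) : H := \sum_(k < a) w k 0 *: unit_vec k.

(** The matrix fills the upper left corner of an infinite matrix that is zero elsewhere, so matrices
    of all shapes act on the same space. *)
Definition mxop a b (A : 'M[C]_(a, b)) (u : H) : H := col_ell2 (A *m ell2_col b u).

Lemma unit_vecE n i : (unit_vec n : H) i = (i == n)%:R. Proof. by []. Qed.

Lemma col_ell2E a (w : 'cV[C]_a) i :
  col_ell2 w i = if insub i is Some k then w k 0 else 0.
Proof.
rewrite /col_ell2 ell2_sum; under eq_bigr do rewrite ell2Z unit_vecE.
case: insubP => [k _ <-|].
  rewrite (bigD1 k) //= eqxx mulr1 big1 ?addr0 // => j jk.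
  by rewrite val_eqE eq_sym (negPf jk) mulr0.
rewrite -leqNgt => ai; rewrite big1 // => j _.
by rewrite gtn_eqF ?mulr0 //; apply: leq_trans ai.
Qed.

Lemma col_ell2K a (w : 'cV[C]_a) : ell2_col a (col_ell2 w) = w.
Proof. by apply/matrixP => i j; rewrite mxE col_ell2E ord1 valK. Qed.

Lemma col_ell2_ge a (w : 'cV[C]_a) i : (a <= i)%N -> col_ell2 w i = 0.
Proof. by move=> ai; rewrite col_ell2E insubF // ltnNge ai. Qed.

Lemma col_ell2L a c (w z : 'cV[C]_a) :
  col_ell2 (c *: w + z) = c *: col_ell2 w + col_ell2 z.
Proof.
apply: ell2_ext => i; rewrite ell2D ell2Z !col_ell2E.
by case: insub => [k|]; rewrite ?mxE ?mulr0 ?addr0 // !mxE.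
Qed.

Lemma ell2_colL b c (u v : H) : ell2_col b (c *: u + v) = c *: ell2_col b u + ell2_col b v.
Proof. by apply/matrixP => i j; rewrite !mxE. Qed.

Lemma dot_col_ell2 a (w : 'cV[C]_a) (v : H) :
  dot (col_ell2 w) v = (adjmx (ell2_col a v) *m w) 0 0.
Proof.
rewrite /col_ell2 dot_suml mxE; apply: eq_bigr => k _.
by rewrite dotZl dotC dot_unitr adjmxE mxE mulrC.
Qed.

Lemma mxop_mul a b d (A : 'M[C]_(a, b)) (B : 'M[C]_(b, d)) :
  mxop (A *m B) = mxop A \o mxop B.
Proof. by apply/funext => u; rewrite /mxop /= col_ell2K mulmxA. Qed.

Lemma mxopL a b c (A B : 'M[C]_(a, b)) : mxop (c *: A + B) = c *: mxop A + mxop B.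
Proof.
apply/funext => u; rewrite /mxop !fctE /= mulmxDl -scalemxAl.
exact: col_ell2L.
Qed.

Lemma mxop_dot a b (A : 'M[C]_(a, b)) u v : dot (mxop A u) v = dot u (mxop (adjmx A) v).
Proof.
rewrite [RHS]dotC !dot_col_ell2 -[in RHS]adjmxE !adjmx_mul !adjmxK.
by rewrite -mulmxA.
Qed.

Lemma bounded_mxop a b (A : 'M[C]_(a, b)) : bounded_op (mxop A).
Proof.
split=> [c u v|].
  by rewrite /mxop ell2_colL mulmxDr -scalemxAr col_ell2L.
exists (\sum_(k < a) \sum_(j < b) nc (A k j)) => u.
rewrite /mxop /col_ell2 mulr_suml.
apply: (@le_trans _ _ (\sum_(k < a) l2norm ((A *m ell2_col b u) k 0 *: (unit_vec k : H)))).
  elim/big_rec2: _ => [|k x y _ h]; first by rewrite l2norm0.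
  by apply: le_trans (l2norm_triangle _ _) _; rewrite lerD2l.
apply: ler_sum => k _; rewrite l2normZ (l2norm_orthonormal _ (@unit_basis R).1) mulr1.
rewrite mxE; apply: le_trans (normc_sum _ _ _) _; rewrite mulr_suml.
apply: ler_sum => j _; rewrite Normc.normcM mxE.
by rewrite ler_wpM2l ?normc_ge0 ?coord_le_l2norm.
Qed.

Lemma adjop_mxop a b (A : 'M[C]_(a, b)) : adjop (mxop A) = mxop (adjmx A).
Proof. by apply: adjopP => u v; exact: mxop_dot. Qed.

Lemma sqabs_mxop a b (A : 'M[C]_(a, b)) : sqabs (mxop A) = mxop (adjmx A *m A).
Proof. by rewrite mxop_mul -adjop_mxop. Qed.

Lemma mxop0 a b : mxop (0 : 'M[C]_(a, b)) = 0.
Proof.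
apply/funext => u; rewrite /mxop mul0mx; apply: ell2_ext => i.
by rewrite col_ell2E; case: insub => // k; rewrite mxE.
Qed.

Lemma mxop_sum (I : Type) (r : seq I) a b (F : I -> 'M[C]_(a, b)) :
  mxop (\sum_(i <- r) F i) = \sum_(i <- r) mxop (F i).
Proof.
elim/big_rec2: _ => [|i x y _ <-]; first exact: mxop0.
by have := mxopL 1 (F i) y; rewrite !scale1r.
Qed.

Lemma mxopZ a b c (A : 'M[C]_(a, b)) : mxop (c *: A) = c *: mxop A.
Proof. by have := mxopL c A 0; rewrite mxop0 !addr0. Qed.

(** Eigenvectors of the corner, completed by the remaining unit vectors to a basis of l^2. *)
Definition eigbasis b (U : 'M[C]_b) (n : nat) : H :=
  if insub n is Some j then col_ell2 (col j (adjmx U)) else unit_vec n.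

Lemma eigbasis_ord b (U : 'M[C]_b) (j : 'I_b) : eigbasis U j = col_ell2 (col j (adjmx U)).
Proof. by rewrite /eigbasis valK. Qed.

Lemma eigbasis_ge b (U : 'M[C]_b) n : (b <= n)%N -> eigbasis U n = unit_vec n.
Proof. by move=> bn; rewrite /eigbasis insubF // ltnNge bn. Qed.

Lemma ell2_col_unit b n : (b <= n)%N -> ell2_col b (unit_vec n : H) = 0.
Proof.
move=> bn; apply/matrixP => i j; rewrite !mxE /= ltn_eqF //.
exact: leq_trans bn.
Qed.

Lemma dot_eigbasis b (U : 'M[C]_b) u (j : 'I_b) :
  dot u (eigbasis U j) = (U *m ell2_col b u) j 0.
Proof.
rewrite eigbasis_ord dotC dot_col_ell2 -adjmxE adjmx_mul adjmxK.
by rewrite !mxE; apply: eq_bigr => k _; rewrite !mxE conjcK.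
Qed.

Lemma mulmx_col a b d (A : 'M[C]_(a, b)) (B : 'M[C]_(b, d)) j :
  A *m col j B = col j (A *m B).
Proof. by rewrite !colE mulmxA. Qed.

Lemma eigbasis_basis b (U : 'M[C]_b) : U *m adjmx U = 1%:M ->
  orthonormal_basis (eigbasis U).
Proof.
move=> UU; split=> [i j|u h].
  have [jb|bj] := ltnP j b; last first.
    rewrite (eigbasis_ge U bj) dot_unitr; have [ib|bi] := ltnP i b.
      rewrite -[ i ]/(val (Ordinal ib)) eigbasis_ord col_ell2_ge //.
      by rewrite (ltn_eqF (leq_trans ib bj)).
    by rewrite eigbasis_ge //= eq_sym.
  rewrite -[j]/(val (Ordinal jb)) dot_eigbasis; have [ib|bi] := ltnP i b.
    rewrite -[ i ]/(val (Ordinal ib)) eigbasis_ord col_ell2K mulmx_col UU.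
    by rewrite !mxE eq_sym.
  rewrite eigbasis_ge // ell2_col_unit // mulmx0 mxE.
  by rewrite gtn_eqF // (leq_trans jb).
have UU' : adjmx U *m U = 1%:M by exact: mulmx1C.
apply: ell2_ext => i; have [ib|bi] := ltnP i b; last first.
  by rewrite -dot_unitr -(eigbasis_ge U bi) h.
have : ell2_col b u = 0.
  rewrite -[ell2_col b u]mul1mx -UU' -mulmxA.
  suff -> : U *m ell2_col b u = 0 by rewrite mulmx0.
  by apply/matrixP => k l; rewrite ord1 -dot_eigbasis h mxE.
by move=> /matrixP/(_ (Ordinal ib) 0); rewrite !mxE.
Qed.

Lemma mxop_eigbasis b (U : 'M[C]_b) (lam : 'I_b -> R) (i : nat) :
  U *m adjmx U = 1%:M ->
  mxop (adjmx U *m rdiag lam *m U) (eigbasis U i) =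
  (odflt 0 (omap lam (insub i)))%:C%C *: eigbasis U i.
Proof.
move=> UU; have [ib|bi] := ltnP i b; last first.
  rewrite insubF; last by rewrite ltnNge bi.
  rewrite scale0r /mxop eigbasis_ge // ell2_col_unit // mulmx0.
  by apply: ell2_ext => k; rewrite col_ell2E; case: insub => // l; rewrite mxE.
rewrite insubT /=; set j := Sub i ib; rewrite -[ i ]/(val j) eigbasis_ord /mxop col_ell2K.
(* Zero summands bring both sides to the shape [c *: w + z] of [col_ell2L]. *)
rewrite -[X in col_ell2 X]addr0 -[RHS]addr0 -[in RHS](_ : col_ell2 (0 : 'cV_b) = 0); last first.
  by apply: ell2_ext => k; rewrite col_ell2E; case: insub => // l; rewrite mxE.
rewrite -col_ell2L; congr (col_ell2 (_ + _)).
rewrite mulmx_col -!mulmxA UU mulmx1 /rdiag.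
apply/matrixP => k l; rewrite !mxE (bigD1 j) //= !mxE eqxx mulr1n big1 ?addr0 1?mulrC //.
by move=> x xj; rewrite !mxE (negPf xj) mulr0n mulr0.
Qed.

(** Outside the corner the eigenvalue is 0 and must remain 0 in the power. This excludes s = 0,
    since 0 to the power 0 is 1. *)
Lemma mxop_opow b (G U : 'M[C]_b) lam (s : R) : spectral_form G U lam -> s != 0 ->
  is_opow (mxop G) s (mxop (adjmx U *m rdiag (fun j => lam j `^ s) *m U)).
Proof.
move=> [UU l0 ->] s0; split; [exact: bounded_mxop|exact: bounded_mxop|].
exists (eigbasis U), (fun i => odflt 0 (omap lam (insub i))); split.
  exact: eigbasis_basis.
move=> n; split; first by case: insub => //=.
  exact: mxop_eigbasis.
rewrite mxop_eigbasis //; congr (_%:C%C *: _).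
by case: insub => //=; rewrite powR0.
Qed.

Lemma eseries_finite (f : nat -> \bar R) n : (forall i, (n <= i)%N -> f i = 0%E) ->
  (\sum_(i <oo) f i = \sum_(0 <= i < n) f i)%E.
Proof.
move=> h; apply: lim_near_cst => //; exists n => // k /= nk.
rewrite (@big_cat_nat _ _ _ n) //= [X in (_ + X)%E]big_nat_cond.
rewrite [X in (_ + X)%E]big1 ?adde0 //.
by move=> i /andP[/andP[ni _] _]; exact: h.
Qed.

Lemma trace_mxop b (M : 'M[C]_b) : trace (mxop M) = (CRe (\tr M))%:E.
Proof.
have e i : CRe (dot (mxop M (unit_vec i)) (unit_vec i)) =
    if insub i is Some j then CRe (M j j) else 0.
  rewrite dot_unitr col_ell2E; case: insubP => [j _ <-|] //.
  rewrite mxE; under eq_bigr do rewrite mxE unit_vecE val_eqE.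
  rewrite (bigD1 j) //= eqxx mulr1 big1 ?addr0 // => k kj.
  by rewrite (negPf kj) mulr0.
rewrite /trace (@eseries_finite _ b) => [|i bi]; last first.
  by rewrite e insubF // ltnNge bi.
rewrite big_mkord sumEFin; congr _%:E.
by rewrite /mxtrace Re_sum; apply: eq_bigr => i _; rewrite e valK.
Qed.

Lemma spectral_powR b (G U : 'M[C]_b) lam (s : R) : spectral_form G U lam ->
  spectral_form (adjmx U *m rdiag (fun j => lam j `^ s) *m U) U (fun j => lam j `^ s).
Proof. by case=> UU l0 _; split => // j; exact: powR_ge0. Qed.

Lemma absop_mxop a b (A : 'M[C]_(a, b)) U lam :
  spectral_form (adjmx A *m A) U lam ->
  absop (mxop A) = mxop (adjmx U *m rdiag (fun j => lam j `^ 2^-1) *m U).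
Proof.
move=> h; rewrite /absop /sqrtop sqabs_mxop.
by apply: opowE; apply: mxop_opow h _; rewrite invr_neq0 // pnatr_eq0.
Qed.

Lemma schatten_mxop a b (A : 'M[C]_(a, b)) U lam (p : R) : 0 < p ->
  spectral_form (adjmx A *m A) U lam ->
  schatten p (mxop A) = ((\sum_j lam j `^ (p / 2)) `^ p^-1)%:E.
Proof.
move=> p0 h; rewrite /schatten ifT; last first.
  apply/asboolP; split; first exact: bounded_mxop.
  rewrite sqabs_mxop; eexists; apply: mxop_opow h _.
  by rewrite invr_neq0 // pnatr_eq0.
rewrite (absop_mxop h) (opowE (mxop_opow (spectral_powR _ h) _)) ?gt_eqF //.
rewrite trace_mxop -poweR_EFin; congr (_%:E `^ _)%E.
rewrite (spectral_trace (spectral_powR p (spectral_powR 2^-1 h))) /=.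
by apply: eq_bigr => j _; rewrite -powRrM mulrC.
Qed.

Lemma schatten_mxop_fin a b (A : 'M[C]_(a, b)) (p : R) : 0 < p ->
  (schatten p (mxop A) < +oo)%E.
Proof.
by move=> p0; have [U [lam h]] := gram_spectral A; rewrite (schatten_mxop p0 h) ltry.
Qed.

Lemma schatten_gram a a' b (A : 'M[C]_(a, b)) (B : 'M[C]_(a', b)) (p : R) : 0 < p ->
  adjmx A *m A = adjmx B *m B -> schatten p (mxop A) = schatten p (mxop B).
Proof.
move=> p0 AB; have [U [lam h]] := gram_spectral A.
by rewrite (schatten_mxop p0 h); rewrite AB in h; rewrite (schatten_mxop p0 h).
Qed.

(** A matrix and its modulus have the same Gram matrix. This removes the square root from the square
    functions. *)
Lemma schatten_absop a b (A : 'M[C]_(a, b)) (p : R) : 0 < p ->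
  schatten p (absop (mxop A)) = schatten p (mxop A).
Proof.
move=> p0; have [U [lam h]] := gram_spectral A.
rewrite (absop_mxop h); apply: schatten_gram => //.
have [UU l0 ->] := h.
rewrite !adjmx_mul adjmxK adj_rdiag !mulmxA.
rewrite -(mulmxA _ U (adjmx U)) UU mulmx1 -(mulmxA _ (rdiag _) (rdiag _)) mul_rdiag.
congr (_ *m rdiag _ *m _); apply/funext => j.
by rewrite -expr2 powR12_sqrt // sqr_sqrtr.
Qed.

(** The Gram matrix is n times a projection, so its eigenvalues are 0 or n, and lam^(p/2) = n^(p/2 -
    1) lam for each of them. The sum of the eigenvalues is the trace. *)
Lemma schatten_projection a b (A : 'M[C]_(a, b)) (p n : R) : 2 < p -> 0 < n ->
  (adjmx A *m A) *m (adjmx A *m A) = n%:C%C *: (adjmx A *m A) ->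
  schatten p (mxop A) = ((n `^ (p / 2 - 1) * CRe (\tr (adjmx A *m A))) `^ p^-1)%:E.
Proof.
move=> p2 n0 GG; have p0 : 0 < p by apply: lt_trans p2.
have [U [lam h]] := gram_spectral A.
rewrite (schatten_mxop p0 h) (spectral_trace h) /= mulr_sumr; congr (_ `^ _)%:E.
apply: eq_bigr => j _; have := spectral_sqr h GG j.
have [->|l0] := eqVneq (lam j) 0.
  by move=> _; rewrite mulr0 powR0 // gt_eqF // divr_gt0.
rewrite expr2 => /(mulIf l0) ->; rewrite -{3}(powRr1 (ltW n0)) -powRD ?subrK //.
by rewrite (gt_eqF n0) implybT.
Qed.

(** A single term of the sum of the powers of the eigenvalues suffices, so the rest of the spectrum
    need not be known. *)
Lemma schatten_eigen_ge a b (A : 'M[C]_(a, b)) (p c : R) (v : 'cV[C]_b) : 0 < p ->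
  v != 0 -> adjmx A *m A *m v = c%:C%C *: v ->
  ((c `^ 2^-1)%:E <= schatten p (mxop A))%E.
Proof.
move=> p0 v0 hv; have [U [lam h]] := gram_spectral A.
have [j lj] := spectral_ge h v0 hv.
have c0 : 0 <= c by rewrite -lj; case: h.
rewrite (schatten_mxop p0 h) lee_fin.
have -> : c `^ 2^-1 = (c `^ (p / 2)) `^ p^-1.
  by rewrite -powRrM mulrAC divff ?mul1r // gt_eqF.
apply: ge0_ler_powR; rewrite ?nnegrE ?powR_ge0 ?invr_ge0 //; first exact: ltW.
  by apply: sumr_ge0 => k _; exact: powR_ge0.
rewrite (bigD1 j) //= lj lerDl.
by apply: sumr_ge0 => k _; exact: powR_ge0.
Qed.

End FiniteMatrices.

(** * Bochner integrals of step functions *)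

Section StepFunctions.
Context {R : realType} {d : measure_display} {T : measurableType d}.
Local Notation C := R[i].
Local Notation nc := (@Normc.normc R).

(** Compared with [simple], no norm is involved. Since all preimages are measurable, composing with
    an arbitrary map gives a step function again. *)
Definition step (U : Type) (f : T -> U) : Prop :=
  finite_set (range f) /\ forall v, measurable (f @^-1` [set v]).

Lemma step_preimage (U : Type) (f : T -> U) (B : set U) : step f -> measurable (f @^-1` B).
Proof.
move=> [ff mf]; have -> : f @^-1` B = \bigcup_(v in range f `&` B) f @^-1` [set v].
  apply/seteqP; split=> [x Bx|x [v [_ +] /= fv]]; last by rewrite -fv.
  by exists (f x) => //; split => //; exists x.
by apply: fin_bigcup_measurable => //; exact: finite_setIl.
Qed.

Lemma step_comp (U W : Type) (f : T -> U) (h : U -> W) : step f -> step (h \o f).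
Proof.
move=> sf; split=> [|v]; last by rewrite comp_preimage; exact: step_preimage.
rewrite (_ : range _ = h @` range f); first by apply: finite_image; case: sf.
by rewrite image_comp.
Qed.

Lemma step_pair (U W : Type) (f : T -> U) (g : T -> W) :
  step f -> step g -> step (fun x => (f x, g x)).
Proof.
move=> [ff mf] [fg mg]; split=> [|[u w]].
  apply: (sub_finite_set _ (finite_setX ff fg)) => _ [x _ <-].
  by split; exists x.
rewrite (_ : _ @^-1` _ = f @^-1` [set u] `&` g @^-1` [set w]); first exact: measurableI.
by apply/seteqP; split => x /= [-> ->].
Qed.

Lemma step_comp2 (U W Z : Type) (h : U -> W -> Z) (f : T -> U) (g : T -> W) :
  step f -> step g -> step (fun x => h (f x) (g x)).
Proof. by move=> sf sg; have := step_comp (fun z => h z.1 z.2) (step_pair sf sg). Qed.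

Lemma step_cst (U : Type) (v : U) : step (fun _ : T => v).
Proof.
split=> [|w].
  by apply: (sub_finite_set _ (finite_set1 v)) => _ [x _ <-].
have [<-|vw] := pselect (v = w).
  by rewrite (_ : _ @^-1` _ = setT) //; apply/seteqP; split.
rewrite (_ : _ @^-1` _ = set0) //; by apply/seteqP; split.
Qed.

Lemma step_sum (V : zmodType) (I : Type) (r : seq I) (P : pred I) (F : I -> T -> V) :
  (forall i, step (F i)) -> step (fun x => \sum_(i <- r | P i) F i x).
Proof.
move=> sF; elim: r => [|i r IH].
  by under eq_fun do rewrite big_nil; exact: step_cst.
under eq_fun do rewrite big_cons; case: (P i) => //.
exact: (step_comp2 (fun a b => a + b)).
Qed.

Lemma step_prod (V : comPzRingType) (I : Type) (r : seq I) (F : I -> T -> V) :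
  (forall i, step (F i)) -> step (fun x => \prod_(i <- r) F i x).
Proof.
move=> sF; elim: r => [|i r IH].
  by under eq_fun do rewrite big_nil; exact: step_cst.
under eq_fun do rewrite big_cons.
exact: (step_comp2 (fun a b => a * b)).
Qed.

Lemma step_measurable (U : Type) d' (W : measurableType d') (f : T -> U) (g : U -> W) :
  step f -> measurable_fun setT (g \o f).
Proof.
by move=> sf _ Y mY; rewrite setTI comp_preimage; exact: step_preimage.
Qed.

Context (mu : probability T R).

Lemma measure_step_comp (U W : choiceType) (f : T -> U) (h : U -> W) (w : W) : step f ->
  mu ((h \o f) @^-1` [set w]) =
  (\sum_(v <- fset_set (range f) | h v == w) mu (f @^-1` [set v]))%E.
Proof.
move=> sf; have [ff mf] := sf.
rewrite -big_filter fsbig_seq ?filter_uniq ?finmap.fset_uniq //.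
rewrite -measure_fin_bigcup //; last first.
  apply/trivIsetP => i j _ _ ij; apply/seteqP; split => // x [/= -> /eqP].
  by rewrite (negPf ij).
congr (mu _); apply/seteqP; split=> [x /= hx|x [v /=]].
  exists (f x) => //=; rewrite mem_filter hx eqxx /= in_fset_set //.
  by apply/mem_set; exists x.
by rewrite mem_filter => /andP[/eqP <- _] ->.
Qed.

Lemma simple_integralE (V : lmodType C) (s : T -> V) : step s ->
  simple_integral mu s =
  \sum_(v <- fset_set (range s)) (fine (mu (s @^-1` [set v])))%:C%C *: v.
Proof. by move=> [fs _]; rewrite /simple_integral fsbig_finite. Qed.

(** The values of [s] are grouped by their images under [phi]. Each linearity property of the
    integral below is an instance, with [phi] a matrix entry, a scalar multiple, a projection of a
    pair or [mxop]. *)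
Lemma simple_integral_comp (V W : lmodType C) (phi : V -> W) (s : T -> V) :
  (forall c u v, phi (c *: u + v) = c *: phi u + phi v) -> step s ->
  phi (simple_integral mu s) = simple_integral mu (phi \o s).
Proof.
move=> lphi ss; rewrite !simple_integralE //; last exact: step_comp.
have phi0 : phi 0 = 0.
  by have := lphi (-1) 0 0; rewrite scaler0 addr0 scaleN1r addNr.
have -> : phi (\sum_(v <- fset_set (range s)) (fine (mu (s @^-1` [set v])))%:C%C *: v) =
    \sum_(v <- fset_set (range s)) (fine (mu (s @^-1` [set v])))%:C%C *: phi v.
  by elim/big_rec2: _ => // v x y _ <-.
have fin v : mu (s @^-1` [set v]) \is a fin_num.
  by apply: fin_num_measure; case: ss.
transitivity (\sum_(w <- fset_set (range (phi \o s)))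
    \sum_(v <- fset_set (range s) | phi v == w)
      (fine (mu (s @^-1` [set v])))%:C%C *: phi v); last first.
  apply: eq_bigr => w _; rewrite measure_step_comp //.
  under [in RHS]eq_bigr do rewrite -(fineK (fin _)).
  rewrite sumEFin /= rmorph_sum scaler_suml.
  by apply: eq_bigr => v /eqP ->.
rewrite (exchange_big_dep xpredT) //= big_seq [RHS]big_seq.
apply: eq_bigr => v; rewrite in_fset_set; last by case: ss.
move=> /set_mem[x _ sx].
rewrite -big_filter (eq_in_filter (a2 := pred1 (phi v))) => [|w _ /=]; last by rewrite eq_sym.
rewrite filter_pred1_uniq ?finmap.fset_uniq ?big_seq1 //.
rewrite in_fset_set; last by case: (step_comp phi ss).
by apply/mem_set; exists x => //=; rewrite sx.
Qed.

Lemma normc_simple_integral (h : T -> C) : step h ->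
  ((nc (simple_integral mu h))%:E <= \int[mu]_x (nc (h x))%:E)%E.
Proof.
move=> sh; have [fh mh] := sh.
have -> : (\int[mu]_x (nc (h x))%:E =
    \sum_(v <- fset_set (range h)) (nc v)%:E * mu (h @^-1` [set v]))%E.
  rewrite (eq_integral (fun x => \sum_(v <- fset_set (range h))
      (nc v)%:E * (\1_(h @^-1` [set v]) x)%:E)%E); last first.
    move=> x _; rewrite (bigD1_seq (h x)) ?finmap.fset_uniq //=; last first.
      by rewrite in_fset_set //; apply/mem_set; exists x.
    rewrite indicE mem_set // mule1 big1 ?adde0 // => v vx.
    by rewrite indicE memNset ?mule0 // => hv; rewrite -hv eqxx in vx.
  have mi v : measurable_fun setT (fun x => (\1_(h @^-1` [set v]) x : R)%:E).
    by apply/measurable_EFinP; exact: measurable_indic.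
  rewrite ge0_integral_sum //; last first.
  - by move=> v x _; rewrite mule_ge0 // lee_fin ?normc_ge0 // indicE.
  - by move=> v; apply: measurable_funeM.
  apply: eq_bigr => v _; rewrite ge0_integralZl_EFin ?normc_ge0 //.
    by rewrite integral_indic // setIT.
rewrite simple_integralE //.
under [leRHS]eq_bigr => v _ do rewrite -(fineK (fin_num_measure mu _ (mh v))) -EFinM.
rewrite sumEFin lee_fin; apply: le_trans (normc_sum _ _ _) _.
apply: ler_sum => v _ /=; rewrite Normc.normcM normc_real mulrC.
by rewrite ger0_norm // fine_ge0.
Qed.

End StepFunctions.

(** * Bochner integrals tested by scalar functionals *)

Section BochnerUniqueness.
Context {R : realType} {d : measure_display} {T : measurableType d}.
Context (mu : probability T R) (V : lmodType R[i]) (nrm : V -> \bar R).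
Context (I : Type) (phi : I -> V -> R[i]).
Local Notation nc := (@Normc.normc R).
Hypothesis nrm0 : nrm 0 = 0%E.
Hypothesis phiL : forall i c u v, phi i (c *: u + v) = c * phi i u + phi i v.
Hypothesis phi_le : forall i v, ((nc (phi i v))%:E <= nrm v)%E.
Hypothesis phi_sep : forall u v, (nrm u < +oo)%E -> (nrm v < +oo)%E ->
  (forall i, phi i u = phi i v) -> u = v.

(* Comparing two Bochner integrals through scalar functionals dominated by [nrm]
   avoids the triangle inequality for [nrm], that is, for the Schatten norms. *)
Lemma is_bochner_unique (f : T -> V) v i : step f -> is_bochner mu nrm f v ->
  phi i v = phi i (simple_integral mu f).
Proof.
move=> sf [_ [s [ss _ cs1 cs2]]].
apply/eqP; rewrite -subr_eq0; apply/eqP/Normc.eq0_normc/eqP.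
rewrite eq_le normc_ge0 andbT -lee_fin.
have cv : (\int[mu]_x nrm (f x - s k x) + nrm (simple_integral mu (s k) - v))%E
    @[k --> \oo] --> (0 + 0)%E by exact: cvgeD.
rewrite adde0 in cv; apply: (cvge_to_ge cv); apply: nearW => k.
have sk : step (s k) by have [_] := ss k.
(* [simple_integral] sums over the values of one function, and f and s_k have different level sets.
   Additivity is obtained by integrating the pair (f, s_k) and applying this linear map. *)
pose g (z : V * V) := phi i (z.1 - z.2).
have gL c (z w : V * V) : g (c *: z + w) = c *: g z + g w.
  by rewrite /g /= opprD addrACA -scalerBr phiL.
have spair : step (fun x => (f x, s k x)) by exact: step_pair.
have e1 : phi i (simple_integral mu f) - phi i (simple_integral mu (s k)) =
    simple_integral mu (fun x => phi i (f x - s k x)).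
  have -> : simple_integral mu f = (simple_integral mu (fun x => (f x, s k x))).1.
    by rewrite (simple_integral_comp mu (phi := fst)).
  have -> : simple_integral mu (s k) = (simple_integral mu (fun x => (f x, s k x))).2.
    by rewrite (simple_integral_comp mu (phi := snd)).
  rewrite -(simple_integral_comp mu gL spair) /g.
  have := phiL i (-1) (simple_integral mu (fun x => (f x, s k x))).2
    (simple_integral mu (fun x => (f x, s k x))).1.
  by rewrite scaleN1r addrC mulN1r addrC => ->; rewrite addrC.
have sd : step (fun x => f x - s k x) by apply: (step_comp2 (fun a b => a - b)).
have -> : phi i v - phi i (simple_integral mu f) =
    - simple_integral mu (fun x => phi i (f x - s k x)) - phi i (simple_integral mu (s k) - v).
  rewrite -e1; have := phiL i (-1) v (simple_integral mu (s k)).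
  by rewrite scaleN1r addrC mulN1r => ->; ring.
apply: (@le_trans _ _ ((nc (simple_integral mu (fun x => phi i (f x - s k x))))%:E +
   (nc (phi i (simple_integral mu (s k) - v)))%:E)%E).
  rewrite -EFinD lee_fin; apply: le_trans (normc_triangle _ _) _.
  by rewrite !normc_opp.
apply: leeD; last exact: phi_le.
have sphi : step (fun x => phi i (f x - s k x)) by have := step_comp (phi i) sd.
apply: le_trans (normc_simple_integral mu sphi) _.
apply: ge0_le_integral => //.
- by move=> x _; rewrite lee_fin normc_ge0.
- exact: (step_measurable (fun z => (nc z)%:E) sphi).
- exact: (step_measurable nrm sd).
Qed.

Lemma bochner_step (s : T -> V) : simple nrm s -> (nrm (simple_integral mu s) < +oo)%E ->
  bochner mu nrm s = simple_integral mu s.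
Proof.
move=> ss hs; have st : step s by have [_] := ss.
rewrite /bochner; case: xgetP => [v _ hv|/(_ (simple_integral mu s))].
  apply: phi_sep => // [|i]; first by case: hv.
  exact: is_bochner_unique hv.
case; split => //; exists (fun _ => s); split => //.
- apply: aeW => x; rewrite subrr nrm0; exact: cvg_cst.
- rewrite (_ : (\int[mu]_x _)%E = 0%E); first exact: cvg_cst.
  by rewrite -(integral0 mu setT); apply: eq_integral => x _; rewrite subrr nrm0.
- rewrite subrr nrm0; exact: cvg_cst.
Qed.

End BochnerUniqueness.

(** * Integrals of matrix-valued step functions *)

Section SchattenBochner.
Context {R : realType} {d : measure_display} {T : measurableType d}.
Context (mu : probability T R) (p : R) (hp : 2 < p).
Local Notation C := R[i].
Local Notation H := (ell2 R).
Local Notation nc := (@Normc.normc R).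

Lemma schatten_lty_bounded (A : H -> H) : (schatten p A < +oo)%E -> bounded_op A.
Proof. by rewrite /schatten; case: asboolP => [[]|]; rewrite ?ltxx. Qed.

Lemma schatten0 : schatten p (0 : H -> H) = 0%E.
Proof.
have p0 : 0 < p by apply: lt_trans hp.
rewrite -(mxop0 0 0); have [U [lam h]] := gram_spectral (0 : 'M[C]_(0, 0)).
by rewrite (schatten_mxop p0 h) big_ord0 powR0 // invr_neq0 // gt_eqF.
Qed.

Lemma bochner_mxop a b (A : T -> 'M[C]_(a, b)) : step A ->
  bochner mu (schatten p) (fun x => mxop (A x)) = mxop (simple_integral mu A).
Proof.
move=> sA; have p0 : 0 < p by apply: lt_trans hp.
rewrite (simple_integral_comp mu (@mxopL R a b) sA).
have sm : step (fun x => mxop (A x)) by have := step_comp (@mxop R a b) sA.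
(* Matrix entries separate bounded operators, and [schatten_entry] with Cauchy-Schwarz dominates
   them by the Schatten norm. *)
pose phi (ij : nat * nat) (B : H -> H) := dot (B (unit_vec ij.1)) (unit_vec ij.2).
apply: (@bochner_step _ _ _ mu _ _ _ phi schatten0).
- by move=> ij c u v; rewrite /phi -dotZl -dotDl.
- move=> ij v; apply: le_trans (schatten_entry v ij.1 hp); rewrite lee_fin.
  apply: le_trans (cauchy_schwarz _ _) _.
  by rewrite (l2norm_orthonormal _ (@unit_basis R).1) mulr1.
- move=> u v /schatten_lty_bounded hu /schatten_lty_bounded hv h.
  by apply: bounded_op_entry_ext => // i j; exact: (h (i, j)).
- case: sm => f1 f2; split => // x; exact: schatten_mxop_fin.
- rewrite -(simple_integral_comp mu (@mxopL R a b) sA); exact: schatten_mxop_fin.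
Qed.

Lemma simple_integral_entry a b (A : T -> 'M[C]_(a, b)) i j : step A ->
  (simple_integral mu A) i j = simple_integral mu (fun x => (A x i j : C^o)).
Proof.
move=> sA; apply: (simple_integral_comp mu (V := 'M[C]_(a, b)) (W := C^o)
  (phi := fun B : 'M[C]_(a, b) => B i j) (s := A)) => // c u v.
by rewrite !mxE.
Qed.

Lemma simple_integralZ (c : C) (f : T -> C) : step f ->
  simple_integral mu (fun x => (c * f x : C^o)) = c * simple_integral mu (f : T -> C^o).
Proof.
move=> sf; rewrite (simple_integral_comp mu (V := C^o) (W := C^o)
  (phi := fun z : C => c * z)) // => a u v.
by rewrite mulrDr; congr (_ + _); exact: mulrCA.
Qed.

Lemma simple_integral1 : simple_integral mu (fun _ : T => (1 : C^o)) = 1.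
Proof.
rewrite simple_integralE; last exact: step_cst.
(* Total mass 1 forces a point to exist; without one, the range of the constant function would be
   empty. *)
have [x0 _] : exists x : T, True.
  apply/not_existsP => h; have := @probability_setT _ _ _ mu.
  rewrite (_ : setT = set0) ?measure0; first by move=> /esym/eqP; rewrite onee_eq0.
  by apply/seteqP; split => x // _; apply: (h x).
rewrite (_ : range _ = [set 1]); last first.
  by apply/seteqP; split=> [_ [x _ <-]//|_ ->]; exists x0.
rewrite fset_set1 big_seq_fset1 (_ : _ @^-1` _ = setT); last first.
  by apply/seteqP; split.
by rewrite probability_setT /= scale1r.
Qed.

End SchattenBochner.

(** * Vilenkin characters *)

Section Digits.
Context (m : nat -> nat) (hm : forall k, (2 <= m k)%N).

Lemma M0 : M m 0 = 1%N. Proof. by rewrite /M big_ord0. Qed.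

Lemma MS k : M m k.+1 = (M m k * m k)%N.
Proof. by rewrite /M big_ord_recr. Qed.

Lemma m_gt0 k : (0 < m k)%N. Proof. exact: leq_trans (hm k). Qed.

Lemma M_gt0 k : (0 < M m k)%N.
Proof. by elim: k => [|k IH]; rewrite ?M0 // MS muln_gt0 IH m_gt0. Qed.

Lemma digit_lt n k : (digit m n k < m k)%N.
Proof. by rewrite ltn_mod m_gt0. Qed.

Lemma digit_small n k : (n < M m k)%N -> digit m n k = 0%N.
Proof. by move=> h; rewrite /digit divn_small // mod0n. Qed.

Lemma leq_M j k : (j <= k)%N -> (M m j <= M m k)%N.
Proof.
move/subnKC <-; elim: (k - j)%N => [|i IH]; first by rewrite addn0.
by rewrite addnS MS; apply: leq_trans IH _; rewrite leq_pmulr ?m_gt0.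
Qed.

Lemma ltn_M k : (k < M m k)%N.
Proof.
elim: k => [|k IH]; first by rewrite M0.
rewrite MS; apply: (@leq_trans (M m k * 2)); last by rewrite leq_mul.
by rewrite muln2 -addnn -addn1 leq_add // M_gt0.
Qed.

Lemma digit_expansion n K : n = (\sum_(k < K) digit m n k * M m k + n %/ M m K * M m K)%N.
Proof.
elim: K => [|K IH]; first by rewrite big_ord0 M0 divn1 muln1.
rewrite {1}IH big_ord_recr /= -addnA; congr addn.
rewrite {1}(divn_eq (n %/ M m K) (m K)) -divnMA -MS mulnDl addnC; congr addn.
by rewrite -mulnA MS (mulnC (m K)).
Qed.

Lemma digit_inj a b : (forall k, digit m a k = digit m b k) -> a = b.
Proof.
move=> h.
have aM : (a < M m (maxn a b))%N by apply: leq_ltn_trans (ltn_M _); exact: leq_maxl.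
have bM : (b < M m (maxn a b))%N by apply: leq_ltn_trans (ltn_M _); exact: leq_maxr.
move: (maxn a b) aM bM => K aM bM.
rewrite (digit_expansion a K) (digit_expansion b K) !divn_small // !mul0n !addn0.
by apply: eq_bigr => k _; rewrite h.
Qed.

Definition of_digits (D : nat -> nat) K := (\sum_(k < K) D k * M m k)%N.

Lemma of_digits_lt D K : (forall k, D k < m k)%N -> (of_digits D K < M m K)%N.
Proof.
move=> hD; elim: K => [|K IH]; first by rewrite /of_digits big_ord0 M0.
rewrite /of_digits big_ord_recr MS /= -/(of_digits D K).
apply: (@leq_trans (M m K + D K * M m K)); first by rewrite ltn_add2r.
by rewrite -mulSn mulnC leq_mul.
Qed.

Lemma M_dvd j k : (j <= k)%N -> (M m j %| M m k)%N.
Proof.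
move/subnKC <-; elim: (k - j)%N => [|i IH]; first by rewrite addn0.
by rewrite addnS MS dvdn_mulr.
Qed.

(** Isolates the digit j: every term above it is a multiple of M_(j+1). *)
Lemma of_digits_split D j K : (j < K)%N ->
  exists s, of_digits D K = (of_digits D j + D j * M m j + s * M m j.+1)%N.
Proof.
move/subnKC <-; elim: (K - j.+1)%N => [|i [s IH]].
  by exists 0%N; rewrite addn0 /of_digits big_ord_recr mul0n addn0.
have /dvdnP[c hc] : (M m j.+1 %| M m (j.+1 + i))%N by apply: M_dvd; exact: leq_addr.
exists (s + D (j.+1 + i) * c)%N; rewrite addnS /of_digits big_ord_recr /=.
rewrite -/(of_digits D (j.+1 + i)) IH -addnA; congr addn.
by rewrite [in LHS]hc mulnDl mulnA.
Qed.

Lemma digit_of_digits_lt D K t j : (forall k, D k < m k)%N -> (j < K)%N ->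
  digit m (of_digits D K + t * M m K) j = D j.
Proof.
move=> hD jK; have [s ->] := of_digits_split D jK.
have /dvdnP[c ->] := M_dvd jK.
rewrite -addnA mulnA -mulnDl MS (mulnC (M m j)) mulnA -addnA -mulnDl.
rewrite /digit addnC divnMDl ?M_gt0 // divn_small ?of_digits_lt // addn0.
by rewrite addnC modnMDl modn_small.
Qed.

Lemma digit_of_digits_ge D K t j : (forall k, D k < m k)%N -> (K <= j)%N ->
  digit m (of_digits D K + t * M m K) j = digit m (t * M m K) j.
Proof.
move=> hD Kj; have /dvdnP[c] := M_dvd Kj; rewrite mulnC /digit => ->.
by rewrite !divnMA mulnK ?M_gt0 // addnC divnMDl ?M_gt0 // (divn_small (of_digits_lt K hD)) addn0.
Qed.

End Digits.

(** * Primitive roots of unity *)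

Section RootsOfUnity.
Context {R : realType}.
Local Notation C := R[i].

Definition expi (t : R) : C := Complex (cos t) (sin t).

Lemma expiD s t : expi (s + t) = expi s * expi t.
Proof.
apply/eqP; rewrite eq_complex /= cosD sinD; apply/andP; split; apply/eqP; ring.
Qed.

Lemma expi0 : expi 0 = 1. Proof. by rewrite /expi cos0 sin0. Qed.

Lemma expiMn t n : expi (t * n%:R) = expi t ^+ n.
Proof.
elim: n => [|n IH]; first by rewrite mulr0 expi0 expr0.
by rewrite -natr1 mulrDr mulr1 expiD IH exprSr.
Qed.

Lemma expi_conj t : conjc (expi t) * expi t = 1.
Proof.
rewrite mulrC mul_conjc normc_sqr /= cos2Dsin2 //.
Qed.

Definition uroot (n : nat) : C := expi (2 * pi / n%:R).

Lemma uroot_exp n : (0 < n)%N -> uroot n ^+ n = 1.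
Proof.
move=> n0; rewrite /uroot -expiMn divfK ?pnatr_eq0 -?lt0n //.
by rewrite /expi mulr_natl cos2pi sin2pi.
Qed.

Lemma uroot_neq1 n j : (0 < j < n)%N -> uroot n ^+ j != 1.
Proof.
move=> /andP[j0 jn]; rewrite /uroot -expiMn; apply/eqP => h.
have n0 : 0 < n%:R :> R by rewrite ltr0n (leq_trans _ jn).
(* Half of the angle: it lies strictly between 0 and pi, so sin t > 0 and cos (2 t) = 1 - 2 sin(t)^2
   < 1. *)
pose t : R := pi * (j%:R / n%:R).
have et : 2 * pi / n%:R * j%:R = t + t by rewrite /t; ring.
have : cos (t + t) = 1 by have := congr1 (@complex.Re R) h; rewrite et.
have st : 0 < sin t.
  apply: sin_gt0_pi; rewrite /t mulr_gt0 ?pi_gt0 ?divr_gt0 // ?ltr0n //=.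
  by rewrite gtr_pMr ?pi_gt0 // ltr_pdivrMr // mul1r ltr_nat.
rewrite cosD -!expr2 cos2sin2; nra.
Qed.

Lemma uroot_conj n : conjc (uroot n) * uroot n = 1.
Proof. exact: expi_conj. Qed.

(** The hypothesis is the form taken by conj(psi_a) psi_b at a point with one coordinate 1 and the
    others 0. *)
Lemma uroot_inj n a b : (a < n)%N -> (b < n)%N -> conjc (uroot n ^+ a) * uroot n ^+ b = 1 ->
  a = b.
Proof.
move=> an bn h.
have u0 : uroot n != 0.
  apply/eqP => u0; have := uroot_conj n; rewrite u0 mulr0 => /eqP.
  by rewrite eq_sym oner_eq0.
have e : uroot n ^+ b = uroot n ^+ a.
  have := congr1 (fun z => uroot n ^+ a * z) h.
  rewrite mulr1 mulrA (mulrC (uroot n ^+ a)).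
  by rewrite (rmorphXn (@conjc R)) /= -exprMn uroot_conj expr1n mul1r.
wlog ab : a b an bn h e / (a <= b)%N => [H|].
  case: (leqP a b) => [|/ltnW] ab; first exact: H.
  apply/esym; apply: H => //; rewrite -?e //.
  by rewrite (rmorphXn (@conjc R)) /= -exprMn uroot_conj expr1n.
have [//|nab] := eqVneq a b.
have : uroot n ^+ (b - a) = 1.
  by apply: (mulIf (expf_neq0 a u0)); rewrite -exprD subnK // e mul1r.
move/eqP; rewrite (negPf (uroot_neq1 _)) //.
by rewrite subn_gt0 ltn_neqAle nab ab /= (leq_ltn_trans (leq_subr _ _)).
Qed.

End RootsOfUnity.

(** * Multiplicativity and orthogonality of the characters *)

Section Characters.
Context {R : realType} (m : nat -> nat) (hm : forall k, (2 <= m k)%N).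
Local Notation C := R[i].
Local Notation chi := (@psi R m).

(** Digits beyond [n] vanish, so the added factors are 1. The freedom in [K] allows characters of
    different indices to be written over a common range. *)
Lemma psiE n K (x : G m) : (n <= K)%N ->
  chi n x = \prod_(k < K) uroot (m k) ^+ (digit m n k * nat_of_ord (x k)).
Proof.
move=> nK; rewrite -(subnKC nK) big_split_ord /= [X in _ * X]big1 ?mulr1.
  apply: eq_bigr => k _; rewrite -expiMn natrM /expi.
  have e (a b c d : R) : a * b * c * d = a * d * (b * c) by ring.
  by rewrite e.
move=> k _; rewrite (digit_small (k := n + k)) ?mul0n ?expr0 //.
by apply: leq_trans (ltn_M hm n) _; apply: (leq_M hm); exact: leq_addr.
Qed.

Lemma psi_conj n (x : G m) : conjc (chi n x) * chi n x = 1.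
Proof.
rewrite (psiE x (leqnn n)) (rmorph_prod (@conjc R)) -big_split /= big1 // => k _.
by rewrite (rmorphXn (@conjc R)) /= -exprMn uroot_conj expr1n.
Qed.

Definition shift (g x : G m) : G m := fun k => x k + g k.

Lemma psi_shift n (g x : G m) : chi n (shift g x) = chi n x * chi n g.
Proof.
rewrite !(psiE _ (leqnn n)) -big_split /=; apply: eq_bigr => k _.
rewrite -exprD -mulnDr /shift /=.
(* Addition in 'Z_(m k) reduces modulo this number, which equals m_k because m_k >= 2. *)
have mk : (Zp_trunc (m k)).+2 = m k by rewrite Zp_cast ?hm.
rewrite !(mulnC (digit _ _ _)) !exprM.
rewrite [X in _ ^+ (_ %% X)]mk expr_mod // uroot_exp //.
exact: m_gt0.
Qed.

Lemma step_coord k : step (fun x : G m => x k).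
Proof.
split=> [|j]; first by apply: (sub_finite_set _ (@finite_finset _ setT)).
by apply: sub_sigma_algebra; exists k, j.
Qed.

Lemma step_psi n : step (chi n).
Proof.
apply: step_prod => k.
pose h (y : 'Z_(m k)) : C :=
  let t : R := 2 * pi * (digit m n k)%:R * (nat_of_ord y)%:R / (m k)%:R in
  Complex (cos t) (sin t).
exact: (step_comp h (step_coord k)).
Qed.

Context (mu : probability (G m) R) (hmu : is_haar mu).

Lemma simple_integral_shift (V : lmodType C) (f : G m -> V) g : step f ->
  simple_integral mu (f \o shift g) = simple_integral mu f.
Proof.
move=> [ff mf]; rewrite /simple_integral (_ : range (f \o shift g) = range f).
  apply: eq_fsbigr => v _; congr ((fine _)%:C%C *: v).
  exact: (hmu g (mf v)).
apply/seteqP; split=> _ [x _ <-]; first by exists (shift g x).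
exists (shift (fun k => - g k) x) => //=; congr f.
by apply: functional_extensionality_dep => k; rewrite /shift subrK.
Qed.

(** Translating by the generator of a coordinate where the digits differ multiplies the integral by
    some c != 1, while Haar measure leaves it unchanged. *)
Lemma psi_orthogonal a b :
  simple_integral mu (fun x => (conjc (chi a x) * chi b x : C^o)) = (a == b)%:R.
Proof.
have [->|ab] := eqVneq a b.
  under eq_fun do rewrite psi_conj; exact: simple_integral1.
have [k dk] : exists k, digit m a k != digit m b k.
  apply/not_existsP => h; case/eqP: ab; apply: (digit_inj hm) => k.
  by apply/eqP; apply: contrapT => hk; apply: (h k); apply/negP.
pose g : G m := fun j => if j == k then 1 else 0.
have pg n : chi n g = uroot (m k) ^+ digit m n k.
  have kK : (k < maxn n k.+1)%N by rewrite leq_max leqnn orbT.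
  rewrite (psiE g (leq_maxl n k.+1)) (bigD1 (Ordinal kK)) //= big1 ?mulr1.
    by rewrite /g eqxx /= modn_small ?muln1 // Zp_cast ?hm.
  by move=> j jk; rewrite /g -[k]/(val (Ordinal kK)) val_eqE (negPf jk) /= muln0.
set f := (fun x : G m => _); have sf : step f.
  exact: (step_comp2 (fun y z => conjc y * z) (step_psi a) (step_psi b)).
pose c : C := conjc (chi a g) * chi b g.
have c1 : c != 1.
  apply/eqP; rewrite /c !pg => /uroot_inj-/(_ (digit_lt hm _ _) (digit_lt hm _ _)).
  by move/eqP; rewrite (negPf dk).
have : simple_integral mu f = c * simple_integral mu f.
  rewrite -simple_integralZ // -{1}(simple_integral_shift g sf).
  congr simple_integral; apply/funext => x; rewrite /f /= !psi_shift conjcM /c; ring.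
move=> h; apply/eqP.
have : (1 - c) * simple_integral mu f == 0 by rewrite mulrBl mul1r -h subrr.
by rewrite mulf_eq0 subr_eq0 eq_sym (negPf c1).
Qed.

End Characters.

(** * Multipliers of matrix-valued trigonometric polynomials *)

Section LpNorms.
Context {R : realType} {d : measure_display} {T : measurableType d}.
Context (mu : probability T R) (V : lmodType R[i]) (nrm : V -> \bar R) (p : R).
Hypothesis p0 : 0 < p.

Lemma Lp_norm_cst (f : T -> V) (c : R) : 0 <= c -> (forall x, nrm (f x) = c%:E) ->
  Lp_norm mu nrm p f = c%:E.
Proof.
move=> c0 fc; rewrite /Lp_norm unlock (_ : nrm \o f = cst c%:E); last first.
  by apply/funext => x /=; rewrite fc.
rewrite (eq_integral (cst (c `^ p)%:E)) => [|x _]; last first.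
  by rewrite /= ger0_norm // poweR_EFin.
rewrite integral_cst //= probability_setT mule1.
by rewrite poweR_EFin -powRrM divff ?gt_eqF // powRr1.
Qed.

Lemma Lp_norm_ge (f : T -> V) (c : R) : 0 <= c -> step f ->
  (forall x, (c%:E <= nrm (f x))%E) -> (c%:E <= Lp_norm mu nrm p f)%E.
Proof.
move=> c0 sf fc; have -> : c%:E = ((c `^ p)%:E `^ p^-1)%E :> \bar R.
  by rewrite poweR_EFin -powRrM divff ?gt_eqF // powRr1.
rewrite /Lp_norm unlock; apply: ge0_le_poweR.
- by rewrite invr_ge0 ltW.
- by rewrite lee_fin powR_ge0.
have -> : (c `^ p)%:E = (\int[mu]_(x in setT) cst (c `^ p)%:E x)%E.
  by rewrite integral_cst //= probability_setT mule1.
apply: ge0_le_integral => //.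
- by move=> x _; rewrite lee_fin powR_ge0.
- exact: (step_measurable (fun v => (`|nrm v| `^ p)%E) sf).
move=> x _ /=; rewrite -poweR_EFin; apply: ge0_le_poweR => //; first exact: ltW.
have h := fc x; rewrite gee0_abs //; exact: le_trans h.
Qed.

End LpNorms.

(** * Interval projections as entrywise masks *)

Section Multipliers.
Context {R : realType} (m : nat -> nat) (hm : forall k, (2 <= m k)%N).
Context (mu : probability (G m) R) (hmu : is_haar mu) (p : R) (hp : 2 < p).
Local Notation C := R[i].
Local Notation chi := (@psi R m).

Definition trig_mx a b (A : 'M[C]_(a, b)) (freq : 'I_a -> 'I_b -> nat) (x : G m) :
  'M[C]_(a, b) := \matrix_(i, j) (A i j * chi (freq i j) x).

Lemma step_matrix d (X : measurableType d) a b (F : X -> 'I_a -> 'I_b -> C) :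
  (forall i j, step (fun x => F x i j)) -> step (fun x => \matrix_(i, j) F x i j).
Proof.
move=> sF.
have -> : (fun x => \matrix_(i, j) F x i j) =
    (fun x => \sum_i \sum_j F x i j *: delta_mx i j).
  apply/funext => x; rewrite {1}[LHS]matrix_sum_delta.
  by apply: eq_bigr => i _; apply: eq_bigr => j _; rewrite mxE.
apply: step_sum => i; apply: step_sum => j.
exact: (step_comp (fun c : C => c *: delta_mx i j) (sF i j)).
Qed.

Lemma step_trig_mx a b (A : 'M[C]_(a, b)) freq : step (trig_mx A freq).
Proof.
apply: step_matrix => // i j.
exact: (step_comp (fun c : C => A i j * c) (step_psi m (freq i j))).
Qed.

Lemma fourier_trig_mx a b (A : 'M[C]_(a, b)) freq n :
  fourier mu (schatten p) (fun x => mxop (trig_mx A freq x)) n =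
  mxop (\matrix_(i, j) (A i j * (n == freq i j)%:R)).
Proof.
rewrite /fourier (_ : (fun x => _) = (fun x => mxop (conjc (chi n x) *: trig_mx A freq x))).
  have st : step (fun x => conjc (chi n x) *: trig_mx A freq x).
    exact: (step_comp2 (fun c B => conjc c *: B) (step_psi m n) (step_trig_mx A freq)).
  rewrite bochner_mxop //; congr mxop; apply/matrixP => i j.
  rewrite simple_integral_entry // !mxE -(psi_orthogonal hm hmu n (freq i j)).
  rewrite -simple_integralZ; last first.
    exact: (step_comp2 (fun y z => conjc y * z) (step_psi m n) (step_psi m (freq i j))).
  congr simple_integral; apply/funext => x; rewrite !mxE; ring.
by apply/funext => x; rewrite mxopZ.
Qed.

(** Each entry carries a single frequency, and orthogonality makes the coefficient at n retain
    exactly the entries of frequency n. The projection is thus a 0-1 Schur multiplier. *)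
Lemma P_I_trig_mx lo hi a b (A : 'M[C]_(a, b)) freq x :
  P_I mu (schatten p) lo hi (fun x => mxop (trig_mx A freq x)) x =
  mxop (\matrix_(i, j) ((lo <= freq i j < hi)%N%:R * trig_mx A freq x i j)).
Proof.
rewrite /P_I; under eq_bigr do rewrite fourier_trig_mx -mxopZ.
rewrite -mxop_sum; congr mxop; apply/matrixP => i j.
rewrite summxE !mxE; under eq_bigr do rewrite !mxE.
case: (boolP (lo <= freq i j < hi)%N) => hf.
  rewrite (bigD1_seq (freq i j)) ?mem_index_iota ?iota_uniq //= eqxx mulr1 mul1r.
  rewrite big1 ?addr0; first exact: mulrC.
  by move=> n /negPf ->; rewrite !mulr0.
rewrite mul0r big_nat_cond big1 // => n /andP[hn _].
have [e|_] := eqVneq n (freq i j); last by rewrite !mulr0.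
by rewrite e (negPf hf) in hn.
Qed.

End Multipliers.

(** * The counterexample *)

Section SignMatrices.
Context {R : realType} (n : nat).
Local Notation C := R[i].
Local Notation N := #|{ffun 'I_n -> bool}|.
Local Notation CRe := (@complex.Re R).

Definition sgn (l : 'I_N) (k : 'I_n) : bool := enum_val l k.

Definition flip (k : 'I_n) (s : {ffun 'I_n -> bool}) : {ffun 'I_n -> bool} :=
  [ffun i => s i (+) (i == k)].

Lemma flipK k : involutive (flip k).
Proof. by move=> s; apply/ffunP => i; rewrite !ffunE -addbA addbb addbF. Qed.

Lemma N_gt0 : (0 < N)%N.
Proof. by apply/card_gt0P; exists [ffun=> false]. Qed.

(** Pairing each sign pattern with the one that differs from it at k shows that the sum equals its
    own opposite. *)
Lemma sum_flip k (F : {ffun 'I_n -> bool} -> C) :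
  (forall s, F (flip k s) = - F s) -> \sum_(l < N) F (enum_val l) = 0.
Proof.
move=> hF; rewrite -(big_enum_val F) /=.
set S := \sum_(s in _) _; have hS : S = - S.
  rewrite {1}/S (reindex_inj (inv_inj (flipK k))) /= -sumrN.
  by apply: eq_big => // s _; rewrite hF.
apply/eqP; have : S *+ 2 == 0 by rewrite mulr2n {1}hS addNr.
by rewrite mulrn_eq0.
Qed.

Lemma sum_sign k : \sum_(l < N) (-1) ^+ sgn l k = 0 :> C.
Proof.
apply: (@sum_flip k (fun s => (-1) ^+ s k)) => s.
by rewrite ffunE eqxx addbT; case: (s k); rewrite ?opprK.
Qed.

Lemma sum_sign2 k k' :
  \sum_(l < N) (-1) ^+ sgn l k * (-1) ^+ sgn l k' = N%:R * (k == k')%:R :> C.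
Proof.
have [<-|kk] := eqVneq k k'.
  under eq_bigr do rewrite -signr_addb addbb expr0.
  by rewrite mulr1 sumr_const card_ord.
rewrite mulr0; apply: (@sum_flip k (fun s => (-1) ^+ s k * (-1) ^+ s k')) => s.
rewrite !ffunE eqxx addbT (eq_sym k' k) (negPf kk) addbF.
by case: (s k); rewrite /= ?expr0 ?expr1 !mulN1r ?mul1r ?opprK.
Qed.

(** The entry (N / 4)(J + 1) of the Gram matrix: write each 0-1 entry as (1 + sign) / 2; after
    expansion the sums of a single sign vanish. *)
Lemma sum_mask2 k k' : \sum_(l < N) (~~ sgn l k)%:R * (~~ sgn l k')%:R =
  N%:R / 4 * (1 + (k == k')%:R) :> C.
Proof.
have mask (s : bool) : (~~ s)%:R = (1 + (-1) ^+ s) / 2 :> C.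
  by case: s; rewrite /= ?expr0 ?expr1; field.
transitivity (\sum_(l < N) (4^-1 * (1 + (-1) ^+ sgn l k) +
   4^-1 * ((-1) ^+ sgn l k' + (-1) ^+ sgn l k * (-1) ^+ sgn l k')) : C).
  have e (x y : C) : (1 + x) / 2 * ((1 + y) / 2) = 4^-1 * (1 + x) + 4^-1 * (y + x * y).
    by field.
  by apply: eq_bigr => l _; rewrite !mask e.
rewrite big_split /= -!mulr_sumr !big_split /= !sum_sign sum_sign2 sumr_const card_ord.
by field.
Qed.

Definition sign_mx (u : 'I_N -> C) (w : 'I_n -> C) : 'M[C]_(N, n) :=
  \matrix_(l, k) ((-1) ^+ sgn l k * (u l * w k)).

Definition mask_mx (u : 'I_N -> C) (w : 'I_n -> C) : 'M[C]_(N, n) :=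
  \matrix_(l, k) ((~~ sgn l k)%:R * (u l * w k)).

Definition unimodular (I : Type) (u : I -> C) : Prop := forall i, conjc (u i) * u i = 1.

Lemma unimodular_conj (I : Type) (u : I -> C) :
  unimodular u -> unimodular (fun i => conjc (u i)).
Proof. by move=> hu i; rewrite conjcK mulrC hu. Qed.

Lemma natrC (k : nat) : (k%:R : R)%:C%C = k%:R.
Proof. by rewrite rmorph_nat. Qed.

Lemma conjc_sign (s : bool) : conjc ((-1) ^+ s : C) = (-1) ^+ s.
Proof. exact: (rmorph_sign (@conjc R)). Qed.

Lemma regroup (s a x t b y : C) :
  s * (a * x) * (t * (b * y)) = a * b * (x * y * (s * t)).
Proof. by ring. Qed.

Lemma gram_sign_mx u w : unimodular u -> unimodular w ->
  adjmx (sign_mx u w) *m sign_mx u w = (N%:R)%:M.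
Proof.
move=> hu hw; apply/matrixP => k k'; rewrite !mxE.
transitivity (\sum_(l < N) conjc (w k) * w k' * ((-1) ^+ sgn l k * (-1) ^+ sgn l k')).
  apply: eq_bigr => l _; rewrite adjmxE !mxE !conjcM conjc_sign.
  by rewrite regroup hu mul1r.
rewrite -mulr_sumr sum_sign2; have [<-|_] := eqVneq k k'; last by rewrite !mulr0.
by rewrite hw mul1r mulr1.
Qed.

Lemma schatten_sign_mx u w (p : R) : 2 < p -> unimodular u -> unimodular w ->
  schatten p (mxop (sign_mx u w)) = ((N%:R `^ (p / 2 - 1) * (N%:R * n%:R)) `^ p^-1)%:E.
Proof.
move=> p2 hu hw; rewrite (@schatten_projection _ _ _ _ p N%:R) ?ltr0n ?N_gt0 //.
  by rewrite gram_sign_mx // mxtrace_scalar -natrC -rmorphMn /= mulr_natr.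
by rewrite gram_sign_mx // natrC mul_scalar_mx.
Qed.

(** The Gram matrix is now N x N of rank n. The former orthogonality of columns, read on the other
    side, makes it N times a projection, so the norm is the same. *)
Lemma schatten_sign_mx_tr u w (p : R) : 2 < p -> unimodular u -> unimodular w ->
  schatten p (mxop (sign_mx u w)^T) = ((N%:R `^ (p / 2 - 1) * (N%:R * n%:R)) `^ p^-1)%:E.
Proof.
move=> p2 hu hw; set A := sign_mx u w; pose B := adjmx A^T.
have BA : A^T *m B = N%:R%:M.
  rewrite -[LHS]trmxK trmx_mul trmxK /B.
  have -> : (adjmx A^T)^T = adjmx A by apply/matrixP => i j; rewrite !mxE.
  by rewrite gram_sign_mx // tr_scalar_mx.
rewrite (@schatten_projection _ _ _ _ p N%:R) ?ltr0n ?N_gt0 // -/B.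
  by rewrite mxtrace_mulC BA mxtrace_scalar -natrC -rmorphMn /= mulr_natr.
by rewrite mulmxA -(mulmxA B) BA mul_mx_scalar natrC scalemxAl.
Qed.

(** The all-ones vector is the eigenvector of J + 1 for n + 1; the diagonal unitary [w] turns it
    into the conjugate of [w]. *)
Lemma mask_mx_eigen u w : unimodular u -> unimodular w ->
  adjmx (mask_mx u w) *m mask_mx u w *m (\col_k conjc (w k)) =
  (N%:R * n.+1%:R / 4 : R)%:C%C *: (\col_k conjc (w k)).
Proof.
move=> hu hw; apply/matrixP => k z; rewrite [LHS]mxE.
transitivity (\sum_k' conjc (w k) * (N%:R / 4 * (1 + (k == k')%:R)) : C).
  apply: eq_bigr => k' _; rewrite !mxE mulr_suml -sum_mask2 mulr_sumr.
  apply: eq_bigr => l _; rewrite adjmxE !mxE !conjcM conjc_nat.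
  have e (x y s t : C) : x * y * s * t = t * y * (x * s) by ring.
  by rewrite regroup hu mul1r e hw mul1r.
rewrite -!mulr_sumr big_split /= sumr_const card_ord (bigD1 k) //= eqxx big1 ?addr0.
  have -> : (N%:R * n.+1%:R / 4 : R)%:C%C = N%:R * n.+1%:R / 4 :> C.
    by rewrite rmorphM /= rmorphM /= fmorphV /= !natrC.
  have e (x y t : C) : x * (y / 4 * (t + 1)) = y * (t + 1) / 4 * x by ring.
  by rewrite !mxE e natr1.
by move=> k' kk; rewrite eq_sym (negPf kk).
Qed.

Lemma schatten_mask_mx u w (p : R) : (0 < n)%N -> 0 < p ->
  unimodular u -> unimodular w ->
  (((N%:R * n.+1%:R / 4) `^ 2^-1)%:E <= schatten p (mxop (mask_mx u w)))%E.
Proof.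
move=> n0 p0 hu hw; apply: (schatten_eigen_ge p0 _ (mask_mx_eigen hu hw)).
apply/eqP => /matrixP/(_ (Ordinal n0) 0); rewrite !mxE => h.
by have := hw (Ordinal n0); rewrite h mul0r => /eqP; rewrite eq_sym oner_eq0.
Qed.

End SignMatrices.

(** * The frequencies n(s, k) and the intervals I_s *)

Section Frequencies.
Context (m : nat -> nat) (hm : forall k, (2 <= m k)%N) (n : nat).
Local Notation N := #|{ffun 'I_n -> bool}|.
Implicit Types (l : 'I_N) (k : 'I_n).

(* [base_freq l] is [c_s] and [sign_freq l k] is [n(s, k)], for [s] the sign pattern
   of index [l]; [sgn l k] holds when [s_k = -1]. *)
Definition base_digit l (j : nat) : nat :=
  if insub j is Some k then (if sgn l k then (m j).-1 else 0%N) else 0%N.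

Definition base_freq l : nat := of_digits m (base_digit l) n + l.*2 * M m n.

(** At position k, adding 1 modulo m_k sends 0 to 1 and m_k - 1 to 0. *)
Definition freq_digit l k (j : nat) : nat :=
  if j == k then (~~ sgn l k : nat) else base_digit l j.

Definition sign_freq l k : nat := of_digits m (freq_digit l k) n + l.*2 * M m n.

Lemma base_digitE l k : base_digit l k = if sgn l k then (m k).-1 else 0%N.
Proof. by rewrite /base_digit valK. Qed.

Lemma base_digit_lt l j : (base_digit l j < m j)%N.
Proof.
have := m_gt0 hm j; rewrite /base_digit; case: insub => // k.
by case: ifP => // _; case: (m j).
Qed.

Lemma freq_digit_lt l k j : (freq_digit l k j < m j)%N.
Proof.
rewrite /freq_digit; case: eqP => [_|_]; last exact: base_digit_lt.
by apply: leq_ltn_trans (hm j); case: sgn.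
Qed.

Lemma of_digits_base l : (of_digits m (base_digit l) n < M m n)%N.
Proof. apply: of_digits_lt; exact: base_digit_lt. Qed.

(** Old and new digit sit on opposite sides, which avoids subtraction in [nat]: the frequency rises
    by M_k or drops by (m_k - 1) M_k. *)
Lemma of_digits_freq_eq l k :
  (of_digits m (freq_digit l k) n + base_digit l k * M m k =
   of_digits m (base_digit l) n + ~~ sgn l k * M m k)%N.
Proof.
rewrite /of_digits (bigD1 k) //= [in RHS](bigD1 k) //=.
rewrite /freq_digit eqxx addnAC [RHS]addnAC (addnC (_ * _)%N); congr addn.
by apply: eq_bigr => j jk; rewrite val_eqE (negPf jk).
Qed.

Lemma M_le_half k : (M m k * 2 <= M m n)%N.
Proof.
by apply: leq_trans (leq_M hm (ltn_ord k)); rewrite MS leq_mul.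
Qed.

(** One spare length [c] absorbs the offset r_s < M_n, the other the length of the interval. *)
Lemma double_block_le a b c : (a < b)%N -> (a.*2 * c + c + c <= b.*2 * c)%N.
Proof.
rewrite -leq_double doubleS => ab.
by rewrite -!mulSnr leq_mul.
Qed.

Lemma sign_freq_in l l' k :
  (base_freq l <= sign_freq l' k < base_freq l + M m n)%N = (l' == l) && ~~ sgn l' k.
Proof.
have Mk := M_gt0 hm k; have Mn := M_le_half k.
have b1 := of_digits_base l; have b2 : (of_digits m (freq_digit l' k) n < M m n)%N.
  by apply: of_digits_lt; exact: freq_digit_lt.

have e := of_digits_freq_eq l' k; rewrite base_digitE in e.
rewrite /base_freq /sign_freq.
have [<-|ll] /= := eqVneq l' l.
  (* Same row. The drop (m_k - 1) M_k is positive, so the frequency falls below the left end; the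
     rise M_k is less than M_n, so it stays inside. *)
  have mk : (M m k <= (m k).-1 * M m k)%N by rewrite leq_pmull // -subn1 subn_gt0.
  move: e mk; case: (sgn l' k) => /=; set T := (l'.*2 * _)%N; lia.
(* Different rows lie in disjoint double blocks. *)
have /orP[h|h] : (l' < l)%N || (l < l')%N by rewrite -neq_ltn.
  by have := double_block_le (M m n) h; move: (_ * _)%N (_ * _)%N => T T'; lia.
by have := double_block_le (M m n) h; move: (_ * _)%N (_ * _)%N => T T'; lia.
Qed.

Lemma base_freq_disjoint : equal_disjoint base_freq (fun l => base_freq l + M m n)%N.
Proof.
have Mn := M_gt0 hm n.
split=> [l|l l'|l l' ll j [h1 h2]]; rewrite ?addKn //.
  by rewrite -{1}[base_freq l]addn0 ltn_add2l.
have b1 := of_digits_base l; have b2 := of_digits_base l'.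
move: h1 h2; rewrite /base_freq.
have : (l' < l)%N || (l < l')%N by rewrite -neq_ltn eq_sym.
case/orP => h; have := double_block_le (M m n) h; move: (_ * _)%N (_ * _)%N => T T'; lia.
Qed.

End Frequencies.

(** * The test polynomial and its projections *)

Section SignPolynomial.
Context {R : realType} (m : nat -> nat) (hm : forall k, (2 <= m k)%N) (n : nat).
Local Notation C := R[i].
Local Notation N := #|{ffun 'I_n -> bool}|.
Local Notation chi := (@psi R m).

Lemma digit_M k j : digit m (M m k) j = (j == k).
Proof.
have h i : ((i == k) < m i)%N by apply: leq_ltn_trans (hm i); case: (i == k).
have e : M m k = (of_digits m (fun i => i == k) k.+1 + 0 * M m k.+1)%N.
  rewrite mul0n addn0 /of_digits (bigD1 ord_max) //= eqxx mul1n big1 ?addn0 //.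
  by move=> i; rewrite -val_eqE /= => /negPf ->.
rewrite e; case: (ltnP j k.+1) => jk; first by rewrite digit_of_digits_lt.
rewrite digit_of_digits_ge // mul0n /digit div0n mod0n.
by rewrite gtn_eqF.
Qed.

(** Digits other than k agree. At k, either 0 + 1 = 1, or the exponents add up to m_k, which the
    root of unity does not see. *)
Lemma psi_sign_freq (l : 'I_N) (k : 'I_n) (x : G m) :
  chi (sign_freq m l k) x = chi (base_freq m l) x * chi (M m k) x.
Proof.
pose K := maxn (sign_freq m l k) (maxn (base_freq m l) (M m k)).
rewrite !(psiE hm (K := K)) ?leq_max ?leqnn ?orbT // -big_split /=.
apply: eq_bigr => j _; rewrite -exprD -mulnDl digit_M.
have hb := base_digit_lt hm l; have hf := freq_digit_lt hm l k.
rewrite /sign_freq /base_freq; case: (ltnP j n) => jn; last first.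
  rewrite (digit_of_digits_ge hm _ hf jn) (digit_of_digits_ge hm _ hb jn).
  by rewrite gtn_eqF ?addn0 // (leq_trans (ltn_ord k)).
rewrite (digit_of_digits_lt hm _ hf jn) (digit_of_digits_lt hm _ hb jn).
rewrite /freq_digit; case: eqP => [->|_]; last by rewrite addn0.
rewrite base_digitE; case: (sgn l k) => //=.
by rewrite addn1 prednK ?m_gt0 // mul0n expr0 exprM uroot_exp ?m_gt0 // expr1n.
Qed.

Lemma psi_unimodular (I : Type) (F : I -> nat) (x : G m) :
  unimodular (fun i => chi (F i) x).
Proof. by move=> i; exact: psi_conj. Qed.

Definition sign_poly (x : G m) : 'M[C]_(N, n) :=
  trig_mx (\matrix_(l, k) (-1) ^+ sgn l k) (sign_freq m (n := n)) x.

Definition mask_poly (x : G m) : 'M[C]_(N, n) :=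
  mask_mx (fun l => chi (base_freq m l) x) (fun k => chi (M m k) x).

(** Links the two forms of f: [trig_mx] serves the projections, [sign_mx] the pointwise norm. *)
Lemma sign_polyE x : sign_poly x =
  sign_mx (fun l => chi (base_freq m l) x) (fun k => chi (M m k) x).
Proof. by apply/matrixP => l k; rewrite !mxE psi_sign_freq. Qed.

Definition restrict_row (a b : nat) (s : 'I_a) (B : 'M[C]_(a, b)) : 'M[C]_(a, b) :=
  \matrix_(l, k) ((l == s)%:R * B l k).

(** A Gram matrix is the sum of the contributions of the rows. Since each projection keeps one row,
    the square function is the modulus of a single matrix. *)
Lemma gram_restrict_row a b (B : 'M[C]_(a, b)) :
  \sum_s adjmx (restrict_row s B) *m restrict_row s B = adjmx B *m B.
Proof.
apply/matrixP => k k'; rewrite summxE !mxE.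
apply: eq_bigr => s _; rewrite mxE (bigD1 s) //= big1 ?addr0.
  by rewrite !adjmxE !mxE eqxx !mul1r.
by move=> l ls; rewrite !mxE (negPf ls) !mul0r mulr0.
Qed.

Lemma mask_sign_poly (s : 'I_N) x :
  \matrix_(l, k) ((base_freq m s <= sign_freq m l k < base_freq m s + M m n)%N%:R *
     sign_poly x l k) = restrict_row s (mask_poly x).
Proof.
apply/matrixP => l k; rewrite sign_polyE !mxE sign_freq_in //.
case: eqP => /= _; last by rewrite !mul0r.
rewrite mul1r; case: sgn; first by rewrite /= !mul0r.
by congr (_ * _); rewrite expr0 mul1r.
Qed.

End SignPolynomial.

Lemma sign_average (R : realType) (K : nat) (c : R) :
  ((2 ^+ K)^-1%:E * \sum_(eps : {ffun 'I_K -> bool}) c%:E = c%:E)%E.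
Proof.
rewrite sumEFin -EFinM sumr_const card_ffun card_bool card_ord -(mulr_natl c).
by rewrite natrX mulKf // expf_neq0 // pnatr_eq0.
Qed.

(** * Consequences of the three estimates for the test polynomial *)

Section Estimates.
Context {R : realType} (m : nat -> nat) (hm : forall k, (2 <= m k)%N).
Context (mu : probability (G m) R) (hmu : is_haar mu) (p : R) (hp : 2 < p).
Context (n : nat) (n0 : (0 < n)%N).
Local Notation C := R[i].
Local Notation H := (ell2 R).
Local Notation N := #|{ffun 'I_n -> bool}|.
Local Notation chi := (@psi R m).
Local Notation lo := (@base_freq m n).
Local Notation hi := (fun l => base_freq m l + M m n)%N.

Let p0 : 0 < p. Proof. by apply: lt_trans hp. Qed.

Definition sign_norm : R := (N%:R `^ (p / 2 - 1) * (N%:R * n%:R)) `^ p^-1.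

Definition mask_norm : R := (N%:R * n.+1%:R / 4) `^ 2^-1.

Lemma schatten_sign_poly (x : G m) : schatten p (mxop (sign_poly n x)) = sign_norm%:E.
Proof.
by rewrite (sign_polyE hm) schatten_sign_mx //; exact: psi_unimodular.
Qed.

Lemma schatten_sign_poly_tr (x : G m) : schatten p (mxop (sign_poly n x)^T) = sign_norm%:E.
Proof.
by rewrite (sign_polyE hm) schatten_sign_mx_tr //; exact: psi_unimodular.
Qed.

Lemma step_sign_poly : step (@sign_poly R m n).
Proof. exact: step_trig_mx. Qed.

Lemma in_Lp_step_cst (f : G m -> H -> H) (c : R) : 0 <= c -> step f ->
  (forall x, schatten p (f x) = c%:E) -> in_Lp mu (schatten p) p f.
Proof.
move=> c0 [ff mf] fc; split=> [x||]; first by rewrite fc ltry.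
  exists (fun _ => f); split=> [k|]; first by split => // x; rewrite fc ltry.
  by apply: aeW => x; rewrite subrr (schatten0 hp); exact: cvg_cst.
by rewrite (Lp_norm_cst mu p0 c0 fc) ltry.
Qed.

Lemma P_I_sign_poly s (x : G m) :
  P_I mu (schatten p) (lo s) (hi s) (fun x => mxop (sign_poly n x)) x =
  mxop (restrict_row s (mask_poly n x)).
Proof.
rewrite (P_I_trig_mx hm hmu hp); congr mxop; exact: mask_sign_poly.
Qed.

Lemma sign_poly_tr (x : G m) : (sign_poly n x : 'M[C]_(N, n))^T =
  trig_mx (\matrix_(k, l) (-1) ^+ sgn l k) (fun k l => sign_freq m l k) x.
Proof. by apply/matrixP => k l; rewrite !mxE. Qed.

Lemma P_I_sign_poly_tr s (x : G m) :
  P_I mu (schatten p) (lo s) (hi s) (fun x => mxop (sign_poly n x)^T) x =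
  mxop (restrict_row s (mask_poly n x))^T.
Proof.
under [X in P_I _ _ _ _ X]eq_fun do rewrite sign_poly_tr.
rewrite (P_I_trig_mx hm hmu hp); congr mxop; rewrite -mask_sign_poly //.
by apply/matrixP => k l; rewrite -sign_poly_tr !mxE.
Qed.

Lemma sign_norm_ge0 : 0 <= sign_norm. Proof. exact: powR_ge0. Qed.

Lemma mask_norm_ge0 : 0 <= mask_norm. Proof. exact: powR_ge0. Qed.

Lemma step_mask_mx (u : G m -> 'I_N -> C) (w : G m -> 'I_n -> C) :
  (forall l, step (fun x => u x l)) -> (forall k, step (fun x => w x k)) ->
  step (fun x => mask_mx (u x) (w x)).
Proof.
move=> su sw; apply: step_matrix => l k.
exact: (step_comp2 (fun a b => (~~ sgn l k)%:R * (a * b)) (su l) (sw k)).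
Qed.

(** Shared by the three estimates: [h] is the modulus for the square functions and [mxop] for random
    signs, while [u] and [w] absorb signs and conjugations. *)
Lemma Lp_norm_mask_ge (u : G m -> 'I_N -> C) (w : G m -> 'I_n -> C)
  (f : G m -> H -> H) (h : 'M[C]_(N, n) -> H -> H) :
  (forall l, step (fun x => u x l)) -> (forall k, step (fun x => w x k)) ->
  (forall x, unimodular (u x)) -> (forall x, unimodular (w x)) ->
  (forall B, schatten p (h B) = schatten p (mxop B)) ->
  (forall x, f x = h (mask_mx (u x) (w x))) ->
  (mask_norm%:E <= Lp_norm mu (schatten p) p f)%E.
Proof.
move=> su sw hu hw hh fE; apply: (Lp_norm_ge mu p0 mask_norm_ge0) => [|x].
  have -> : f = h \o (fun x => mask_mx (u x) (w x)) by apply/funext => x; rewrite fE.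
  by apply: step_comp; exact: step_mask_mx.
by rewrite fE hh; exact: schatten_mask_mx.
Qed.

Lemma sign_norm_bound (C0 : R) (f g : G m -> H -> H) : step f ->
  (forall x, schatten p (f x) = sign_norm%:E) ->
  (mask_norm%:E <= Lp_norm mu (schatten p) p g)%E ->
  (in_Lp mu (schatten p) p f ->
    (Lp_norm mu (schatten p) p g <= C0%:E * Lp_norm mu (schatten p) p f)%E) ->
  mask_norm <= C0 * sign_norm.
Proof.
move=> sf fc hg hC; rewrite -lee_fin EFinM; apply: le_trans hg _.
rewrite -(Lp_norm_cst mu p0 sign_norm_ge0 fc); apply: hC.
exact: in_Lp_step_cst sign_norm_ge0 sf fc.
Qed.

Lemma step_mxop_sign_poly : step (fun x : G m => mxop (sign_poly n x : 'M[C]_(N, n))).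
Proof. by have := step_comp (@mxop R _ _) step_sign_poly. Qed.

Lemma step_mxop_sign_poly_tr :
  step (fun x : G m => mxop (sign_poly n x : 'M[C]_(N, n))^T).
Proof. by have := step_comp (fun B => mxop B^T) step_sign_poly. Qed.

Lemma column_bound (C0 : R) :
  (forall f : G m -> H -> H, in_Lp mu (schatten p) p f ->
    (Lp_norm mu (schatten p) p
       (fun x => sqrtop (\sum_(s < N) sqabs (P_I mu (schatten p) (lo s) (hi s) f x))%R)
     <= C0%:E * Lp_norm mu (schatten p) p f)%E) ->
  mask_norm <= C0 * sign_norm.
Proof.
move=> hC; apply: sign_norm_bound step_mxop_sign_poly schatten_sign_poly _ (hC _).
apply: (@Lp_norm_mask_ge (fun x l => chi (lo l) x) (fun x k => chi (M m k) x) _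
  (fun B => absop (mxop B))).
- by move=> l; exact: step_psi.
- by move=> k; exact: step_psi.
- by move=> x; exact: psi_unimodular.
- by move=> x; exact: psi_unimodular.
- by move=> B; exact: schatten_absop.
move=> x; rewrite /absop; congr sqrtop; rewrite sqabs_mxop -gram_restrict_row mxop_sum.
by apply: eq_bigr => s _; rewrite P_I_sign_poly sqabs_mxop.
Qed.

(** For the transposed polynomial each projection is a transposed row. Its adjoint is the entrywise
    conjugate of the row, so the column computation applies with conjugated unitaries. *)
Lemma row_bound (C0 : R) :
  (forall f : G m -> H -> H, in_Lp mu (schatten p) p f ->
    (Lp_norm mu (schatten p) p
       (fun x => sqrtop
          (\sum_(s < N) sqabs (adjop (P_I mu (schatten p) (lo s) (hi s) f x)))%R)
     <= C0%:E * Lp_norm mu (schatten p) p f)%E) ->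
  mask_norm <= C0 * sign_norm.
Proof.
move=> hC; apply: sign_norm_bound step_mxop_sign_poly_tr schatten_sign_poly_tr _ (hC _).
apply: (@Lp_norm_mask_ge (fun x l => conjc (chi (lo l) x))
  (fun x k => conjc (chi (M m k) x)) _ (fun B => absop (mxop B))).
- by move=> l; exact: (step_comp conjc (step_psi m _)).
- by move=> k; exact: (step_comp conjc (step_psi m _)).
- by move=> x; apply: unimodular_conj; exact: psi_unimodular.
- by move=> x; apply: unimodular_conj; exact: psi_unimodular.
- by move=> B; exact: schatten_absop.
move=> x; rewrite /absop; congr sqrtop; rewrite sqabs_mxop -gram_restrict_row mxop_sum.
apply: eq_bigr => s _; rewrite P_I_sign_poly_tr adjop_mxop -sqabs_mxop.
congr (sqabs (mxop _)); apply/matrixP => l k.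
rewrite adjmxE !mxE !conjcM conjc_nat; congr (_ * (_ * _)).
exact: conjc_nat.
Qed.

Lemma LPR_bound (C0 : R) :
  (forall f : G m -> H -> H, in_Lp mu (schatten p) p f ->
    (((2 ^+ N)^-1%:E *
      \sum_(eps : {ffun 'I_N -> bool})
        Lp_norm mu (schatten p) p
          (fun x => (\sum_(s < N) (-1) ^+ eps s *:
             P_I mu (schatten p) (lo s) (hi s) f x)%R) `^ p) `^ p^-1
     <= C0%:E * Lp_norm mu (schatten p) p f)%E) ->
  mask_norm <= C0 * sign_norm.
Proof.
move=> hC; rewrite -lee_fin EFinM.
rewrite -(Lp_norm_cst mu p0 sign_norm_ge0 schatten_sign_poly).
apply: le_trans (hC _ (in_Lp_step_cst sign_norm_ge0 step_mxop_sign_poly schatten_sign_poly)).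
have -> : mask_norm%:E = ((mask_norm `^ p)%:E `^ p^-1)%E :> \bar R.
  by rewrite poweR_EFin -powRrM divff ?gt_eqF // powRr1 // mask_norm_ge0.
apply: ge0_le_poweR; rewrite ?lee_fin ?powR_ge0 ?invr_ge0 ?(ltW p0) //.
(* The lower bound is itself written as an average over the signs, so that the comparison is made
   term by term; the signs of each term go into [u]. *)
rewrite -(sign_average N).
apply: lee_wpmul2l; first by rewrite lee_fin invr_ge0 exprn_ge0.
apply: lee_sum => eps _; rewrite -poweR_EFin; apply: ge0_le_poweR; first exact: ltW.
  by rewrite lee_fin mask_norm_ge0.
apply: (@Lp_norm_mask_ge (fun x l => (-1) ^+ eps l * chi (lo l) x)
  (fun x k => chi (M m k) x) _ (fun B => mxop B)) => //.
- by move=> l; exact: (step_comp (fun c => _ * c) (step_psi m _)).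
- by move=> k; exact: step_psi.
- move=> x l; rewrite conjcM conjc_sign mulrACA.
  by rewrite -signr_addb addbb expr0 mul1r; exact: psi_conj.
- by move=> x; exact: psi_unimodular.
move=> x; rewrite (_ : mask_mx _ _ = \sum_s (-1) ^+ eps s *: restrict_row s (mask_poly n x)).
  by rewrite mxop_sum; apply: eq_bigr => s _; rewrite P_I_sign_poly mxopZ.
apply/matrixP => l k; rewrite summxE !mxE (bigD1 l) //= big1 ?addr0.
  have e (a b c d : C) : a * (b * c * d) = b * (a * (c * d)) by ring.
  by rewrite !mxE eqxx mul1r e.
by move=> s sl; rewrite !mxE eq_sym (negPf sl) mul0r mulr0.
Qed.

End Estimates.

(* [sign_norm] is [N^(1/2) n^(1/p)], whereas [mask_norm] is [(N (n + 1) / 4)^(1/2)]. *)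
Lemma no_uniform_bound (R : realType) (p C : R) : 2 < p ->
  ~ (forall n, (0 < n)%N -> mask_norm n <= C * sign_norm p n).
Proof.
move=> p2 h; have p0 : 0 < p by apply: lt_trans p2.
pose e := 2^-1 - p^-1.
have e0 : 0 < e by rewrite subr_gt0 ltf_pV2 ?posrE.
(* The powers of N cancel, and n + 1 is weakened to n; the factor 2 is the square root of 4. *)
have hn n : (0 < n)%N -> n%:R `^ e <= 2 * C.
  move=> n0; have := h n n0; rewrite /mask_norm /sign_norm.
  move: (N_gt0 n) => N0'; set N := #|_| in N0' *; have N0 : 0 < N%:R :> R by rewrite ltr0n.
  have nR : 0 < n%:R :> R by rewrite ltr0n.
  have -> : (N%:R `^ (p / 2 - 1) * (N%:R * n%:R)) `^ p^-1 =
      N%:R `^ 2^-1 * n%:R `^ p^-1 :> R.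
    rewrite mulrA -{2}(powRr1 (ltW N0)) -powRD; last by rewrite (gt_eqF N0) implybT.
    rewrite subrK powRM ?powR_ge0 ?(ltW nR) // -powRrM.
    by rewrite mulrAC divff ?gt_eqF // mul1r.
  have -> : (N%:R * n.+1%:R / 4) `^ 2^-1 = N%:R `^ 2^-1 * (n.+1%:R `^ 2^-1 / 2) :> R.
    rewrite -mulrA powRM ?(ltW N0) ?divr_ge0 // powRM //; congr (_ * (_ * _)).
    rewrite powR12_sqrt ?invr_ge0 // (_ : 4^-1 = 2^-1 ^+ 2); last by field.
    by rewrite sqrtr_sqr ger0_norm ?invr_ge0.
  rewrite [leRHS]mulrCA ler_pM2l ?powR_gt0 // ler_pdivrMr // => h2.
  have h3 : n%:R `^ 2^-1 <= 2 * C * n%:R `^ p^-1.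
    rewrite (mulrC 2) mulrAC; apply: le_trans h2.
    by apply: ge0_ler_powR; rewrite ?nnegrE ?invr_ge0 // ler_nat.
  rewrite /e powRD; last by rewrite (gt_eqF nR) implybT.
  by rewrite powRN ler_pdivrMr ?powR_gt0.
(* The case n = 1 makes 2 C positive, hence equal to ((2 C)^(1/e))^e. Any n above (2 C)^(1/e) then
   contradicts [hn]. *)
have C1 : 1 <= 2 * C by have := hn 1 isT; rewrite powR1.
have B0 : 0 <= (2 * C) `^ e^-1 by exact: powR_ge0.
have := archi_boundP B0; set n := Num.bound _ => hb.
have n0 : (0 < n)%N by rewrite -(ltr0n R); apply: le_lt_trans hb.
have := hn n n0; apply/negP; rewrite -ltNge.
have -> : 2 * C = ((2 * C) `^ e^-1) `^ e.
  by rewrite -powRrM mulVf ?gt_eqF // powRr1 // (le_trans ler01).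
by apply: gt0_ltr_powR; rewrite ?nnegrE ?ler0n.
Qed.

Theorem theorem1p6 (R : realType) (m : nat -> nat) (hm : forall k, (2 <= m k)%N)
    (mu : probability (G m) R) (hmu : is_haar mu) (p : R) (hp : 2 < p) :
  [/\ ~ column_estimate mu p,
      ~ row_estimate mu p &
      ~ LPR_eq mu p (@schatten R p)].
Proof.
split=> -[C hC]; apply: (no_uniform_bound (C := C) hp) => n n0.
- by apply: (column_bound hm hmu hp n0) => f; exact/hC/base_freq_disjoint.
- by apply: (row_bound hm hmu hp n0) => f; exact/hC/base_freq_disjoint.
- by apply: (LPR_bound hm hmu hp n0) => f; exact/hC/base_freq_disjoint.
Qed.
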